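(* Let $T\in(0,\infty)$, let $X_0,X_1$ be Banach spaces with $X_1\hookrightarrow X_0$ densely and continuously, and let $A\colon[0,T]\to\mathcal{L}(X_1,X_0)$ be strongly measurable in the strong operator topology. Let $p\in(1,\infty)$, $\kappa\in[0,p-1)$ and $q\in(p,\infty)$. Suppose that there is a constant $C_A$ such that \[\|Av\|_{L^p(0,T,w_\kappa;X_0)}\le C_A\|v\|_{\mathrm{MR}^p(0,T,w_\kappa)}\quad\text{for all } v\in \mathrm{MR}^p(0,T,w_\kappa),\] and that $A$ has maximal $L^p(0,T,w_\kappa)$-regularity. Let $B\colon[0,T]\to\mathcal{L}(X_{1-1/q,1},X_0)$ be strongly measurable in the strong operator topology and suppose that $\|B(t)\|_{\mathcal{L}(X_{1-1/q,1},X_0)}\le b(t)$ for $t\in[0,T]$, where $b\in L^q(0,T)$. Then $A+B$ has maximal $L^p(0,T,w_\kappa)$-regularity, and $M_{p,\kappa,A+B}(0,T)\le C$, where $C$ depends only on $p,q,\kappa,X_0,X_1,M_{p,\kappa,A}(0,T)$ and $\|b\|_{L^q(0,T)}$.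
   Context: For $\theta\in(0,1)$ and $r\in[1,\infty]$, $X_{\theta,r}:=(X_0,X_1)_{\theta,r}$ denotes the real interpolation space; since $X_1\hookrightarrow X_{1-1/q,1}$, $B(t)$ is regarded as an element of $\mathcal{L}(X_1,X_0)$ and $(A+B)(t)=A(t)+B(t)$. For $\mu\ge0$, $w_\mu(t)=|t|^\mu$ (the weight is never shifted, also on subintervals). $L^p(a,b,w_\kappa;X)$ is the space of strongly measurable $f\colon(a,b)\to X$ with $\|f\|^p=\int_a^b t^\kappa\|f(t)\|_X^p\,dt<\infty$; $W^{1,p}(a,b,w_\kappa;X)$ is defined analogously. $\mathrm{MR}^p(a,b,w_\kappa):=L^p(a,b,w_\kappa;X_1)\cap W^{1,p}(a,b,w_\kappa;X_0)$ with norm $\max\{\|u\|_{L^p(a,b,w_\kappa;X_1)},\|u\|_{W^{1,p}(a,b,w_\kappa;X_0)}\}$. For an operator family $\mathcal{A}\colon[0,T]\to\mathcal{L}(X_1,X_0)$, $0\le a<b\le T$, $f\in L^1(a,b;X_0)$ and $u_a\in X_0$, a strong solution of $u'+\mathcal{A}u=f$ on $(a,b)$, $u(a)=u_a$, is a function $u\in L^1(a,b;X_1)\cap W^{1,1}(a,b;X_0)$ with $\mathcal{A}u\in L^1(a,b;X_0)$, $u(a)=u_a$ (using the continuous version) and $u'(t)+\mathcal{A}(t)u(t)=f(t)$ for a.e. $t$. $\mathcal{A}$ has maximal $L^p(a,b,w_\kappa)$-regularity if for every $f\in L^p(a,b,w_\kappa;X_0)$ there exists a unique strong solution $u\in\mathrm{MR}^p(a,b,w_\kappa)$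 of $u'+\mathcal{A}u=f$ on $(a,b)$ with $u(a)=0$, and there is a constant $C$ independent of $f$ such that for every $\tau\in(a,b]$ and every strong solution $v\in\mathrm{MR}^p(a,\tau,w_\kappa)$ of $v'+\mathcal{A}v=f$ on $(a,\tau)$ with $v(a)=0$ one has $\|v\|_{\mathrm{MR}^p(a,\tau,w_\kappa)}\le C\|f\|_{L^p(a,\tau,w_\kappa;X_0)}$. The infimum of such $C$ is denoted $M_{p,\kappa,\mathcal{A}}(a,b)$. *)

(* Defs.v *)
From HB Require Import structures.
From mathcomp Require Import all_boot all_order all_algebra.
From mathcomp Require Import all_classical all_reals all_analysis.
Set Implicit Arguments. Unset Strict Implicit. Unset Printing Implicit Defensive.
Import Order.TTheory GRing.Theory Num.Theory.
Import numFieldNormedType.Exports.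
Local Open Scope classical_set_scope.
Local Open Scope ring_scope.

Definition leb (R : realType) := (@lebesgue_measure R).

Record step (R : realType) (X : normedModType R) := Step {
  st_n : nat; st_A : nat -> set R; st_x : nat -> X }.

Definition step_fun (R : realType) (X : normedModType R) (s : step X) (t : R) : X :=
  \sum_(i < st_n s) (\1_(st_A s i) t) *: st_x s i.

Definition step_meas (R : realType) (X : normedModType R) (s : step X) : Prop :=
  forall i, measurable (st_A s i).

Definition step_integrable (R : realType) (X : normedModType R) (D : set R) (s : step X) : Prop :=
  step_meas s /\ forall i, (i < st_n s)%N -> (@leb R (st_A s i `&` D) < +oo)%E.

Definition step_int (R : realType) (X : normedModType R) (D : set R) (s : step X) : X :=
  \sum_(i < st_n s) fine (@leb R (st_A s i `&` D)) *: st_x s i.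

Definition strongly_meas (R : realType) (X : normedModType R) (D : set R) (f : R -> X) : Prop :=
  exists s : nat -> step X, (forall n, step_meas (s n)) /\
    {ae @leb R, forall t, D t -> step_fun (s n) t @[n --> \oo] --> f t}.

Definition is_bochner (R : realType) (X : normedModType R) (D : set R) (f : R -> X) (v : X) : Prop :=
  strongly_meas D f /\
  exists s : nat -> step X, (forall n, step_integrable D (s n)) /\
    ((fun n => (\int[@leb R]_(t in D) (`|step_fun (s n) t - f t|)%:E)%E) @ \oo --> 0%E) /\
    ((fun n => step_int D (s n)) @ \oo --> v).

Definition wLp_int (R : realType) (X : normedModType R) (p kappa a b : R) (f : R -> X) : \bar R :=
  (\int[@leb R]_(t in `]a, b[%classic) ((`|t| `^ kappa) * (`|f t| `^ p))%:E)%E.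

Definition wLp (R : realType) (X : normedModType R) (p kappa a b : R) (f : R -> X) : Prop :=
  strongly_meas `]a, b[%classic f /\ (wLp_int p kappa a b f < +oo)%E.

Definition wLp_norm (R : realType) (X : normedModType R) (p kappa a b : R) (f : R -> X) : R :=
  (fine (wLp_int p kappa a b f)) `^ (p^-1).

(* g (in L^p(a,b,w_kappa;X)) is the derivative of u on (a,b), and c is the value at a of
   the continuous version of u:  u(t) = c + \int_a^t g  for a.e. t in (a,b) *)
Definition is_deriv (R : realType) (X : normedModType R) (p kappa a b : R) (u g : R -> X) (c : X) : Prop :=
  wLp p kappa a b g /\
  {ae @leb R, forall t, `]a, b[%classic t -> is_bochner `]a, t[%classic g (u t - c)}.

Definition wW1p (R : realType) (X : normedModType R) (p kappa a b : R) (u : R -> X) : Prop :=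
  wLp p kappa a b u /\ exists g c, is_deriv p kappa a b u g c.

(* J : X1 -> X0 is the embedding X1 -> X0 *)
Definition MR (R : realType) (X0 X1 : normedModType R) (J : X1 -> X0) (p kappa a b : R) (u : R -> X1) : Prop :=
  wLp p kappa a b u /\ wW1p p kappa a b (J \o u).

(* ||u||_{MR^p(a,b,w_kappa)}, computed with a derivative g of J o u; the W^{1,p} norm is
   (||u||_p^p + ||u'||_p^p)^{1/p} *)
Definition MR_norm (R : realType) (X0 X1 : normedModType R) (J : X1 -> X0) (p kappa a b : R)
    (u : R -> X1) (g : R -> X0) : R :=
  Num.max (wLp_norm p kappa a b u)
    ((wLp_norm p kappa a b (J \o u) `^ p + wLp_norm p kappa a b g `^ p) `^ (p^-1)).

Definition MR_norm_le (R : realType) (X0 X1 : normedModType R) (J : X1 -> X0) (p kappa a b : R)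
    (u : R -> X1) (K : R) : Prop :=
  forall g c, is_deriv p kappa a b (J \o u) g c -> MR_norm J p kappa a b u g <= K.

Definition strong_sol (R : realType) (X0 X1 : normedModType R) (J : X1 -> X0)
    (Aop : R -> X1 -> X0) (a b : R) (f : R -> X0) (ua : X0) (u : R -> X1) : Prop :=
  wLp 1 0 a b u /\ wLp 1 0 a b (J \o u) /\
  wLp 1 0 a b (fun t => Aop t (u t)) /\
  exists g, is_deriv 1 0 a b (J \o u) g ua /\
    {ae @leb R, forall t, `]a, b[%classic t -> g t + Aop t (u t) = f t}.

Definition MR_est (R : realType) (X0 X1 : normedModType R) (J : X1 -> X0)
    (p kappa : R) (Aop : R -> X1 -> X0) (a b : R) (K : R) : Prop :=
  forall f : R -> X0, wLp p kappa a b f ->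
  forall tau, a < tau <= b ->
  forall v : R -> X1, MR J p kappa a tau v -> strong_sol J Aop a tau f 0 v ->
    MR_norm_le J p kappa a tau v (K * wLp_norm p kappa a tau f).

Definition max_reg (R : realType) (X0 X1 : normedModType R) (J : X1 -> X0)
    (p kappa : R) (Aop : R -> X1 -> X0) (a b : R) : Prop :=
  (forall f : R -> X0, wLp p kappa a b f ->
     exists u : R -> X1, MR J p kappa a b u /\ strong_sol J Aop a b f 0 u /\
       forall v : R -> X1, MR J p kappa a b v -> strong_sol J Aop a b f 0 v ->
         {ae @leb R, forall t, `]a, b[%classic t -> v t = u t}) /\
  exists K, MR_est J p kappa Aop a b K.

Definition MR_const (R : realType) (X0 X1 : normedModType R) (J : X1 -> X0)
    (p kappa : R) (Aop : R -> X1 -> X0) (a b : R) : R :=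
  inf [set K | MR_est J p kappa Aop a b K].

Definition Kfun (R : realType) (X0 X1 : normedModType R) (J : X1 -> X0) (t : R) (x : X0) : R :=
  inf [set r | exists (x0 : X0) (x1 : X1), x = x0 + J x1 /\ r = `|x0| + t * `|x1|].

Definition interp_int (R : realType) (X0 X1 : normedModType R) (J : X1 -> X0) (theta : R) (x : X0) : \bar R :=
  (\int[@leb R]_(t in `]0%R, +oo[%classic) ((t `^ (- theta)) * Kfun J t x / t)%:E)%E.

Definition in_interp (R : realType) (X0 X1 : normedModType R) (J : X1 -> X0) (theta : R) (x : X0) : Prop :=
  (interp_int J theta x < +oo)%E.

Definition interp_norm (R : realType) (X0 X1 : normedModType R) (J : X1 -> X0) (theta : R) (x : X0) : R :=
  fine (interp_int J theta x).

Definition Lq_norm (R : realType) (q a b : R) (f : R -> R) : R :=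
  (fine (\int[@leb R]_(t in `]a, b[%classic) (`|f t| `^ q)%:E)%E) `^ (q^-1).

(* f in L^q(a,b) (f measurable assumed separately) *)
Definition Lq_fin (R : realType) (q a b : R) (f : R -> R) : Prop :=
  (\int[@leb R]_(t in `]a, b[%classic) (`|f t| `^ q)%:E < +oo)%E.

(* Main.v *)
(* Write Phi_t(f) for the p-th power of the norm of f in L^p(0, t, w_kappa), S for the solution
   operator of A, and beta(t) for the integral of |b|^q over (0, t).

   By a weighted Hoelder inequality, the integral of |g| over (t - h, t) is at most
   C h^(1 - 1/p) (t^-kappa Phi_t(g))^(1/p).  Applied to u' and to u, this shows that if u(0) = 0,
   then for almost every t the K-functional satisfies
     K(h, u(t)) <= C h^(1 - 1/p) (t^-kappa P)^(1/p) for all h > 0, if Phi_t(u), Phi_t(u') <= P.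
   Splitting the interpolation integral at (delta / b(t))^q, which depends on b rather than on u,
   gives
     t^kappa |B(t) u(t)|^p <= C delta^p t^kappa |u(t)|^p + C_delta |b(t)|^q P.
   After integration this is an estimate of Gronwall type: if Phi_t(F) <= D exp(lambda beta(t)) for
   all t, then Phi_t(B S F) <= rho D exp(lambda beta(t)), where rho is as small as we please once
   delta is small and lambda is large, both depending on p, q, kappa and the constant of A only.
   Hence F = f - B S F is solved by Picard iteration in L^p(0, T, w_kappa; X_0), u = S F solves the
   perturbed problem, and the same bound applied to F = f - B v gives the a priori estimate with a
   constant that involves b only through exp(lambda beta(T)), and T not at all. *)
Require Import Defs.
From HB Require Import structures.
From mathcomp Require Import all_boot all_order all_algebra.
From mathcomp Require Import all_classical all_reals all_analysis measurable_realfun.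
From mathcomp Require Import ring lra.
Set Implicit Arguments. Unset Strict Implicit. Unset Printing Implicit Defensive.
Import Order.TTheory GRing.Theory Num.Theory.
Import numFieldNormedType.Exports.
Import HBNNSimple.
Local Open Scope classical_set_scope.
Local Open Scope ring_scope.

(** * Integrals of almost everywhere measurable functions *)

Section lower_integral.
Context {d : measure_display} {T : measurableType d} {R : realType}.
Variable mu : {measure set T -> \bar R}.
Implicit Types (D E : set T).

(* For nonnegative [f] the integral is a supremum over simple functions below [f], so that
   monotonicity holds without measurability. *)
Lemma ge0_le_lower_integral D (f g : T -> \bar R) :
  (forall x, D x -> 0 <= f x)%E -> (forall x, D x -> f x <= g x)%E ->
  (\int[mu]_(x in D) f x <= \int[mu]_(x in D) g x)%E.
Proof.
move=> f0 fg.
have g0 x : D x -> (0 <= g x)%E by move=> Dx; apply: le_trans (fg x Dx); exact: f0.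
rewrite !ge0_integralE//=; apply: ge_ereal_sup => _ [h hf <-].
apply: ereal_sup_ubound; exists h => // x; apply: le_trans (hf x) _.
by rewrite !patchE; case: ifPn => // /set_mem /fg.
Qed.

Lemma ge0_ae_le_lower_integral D (f g : T -> \bar R) :
  (forall x, D x -> 0 <= f x)%E -> (forall x, D x -> 0 <= g x)%E ->
  {ae mu, forall x, D x -> (f x <= g x)%E} ->
  (\int[mu]_(x in D) f x <= \int[mu]_(x in D) g x)%E.
Proof.
move=> f0 g0 [N [mN N0 subN]].
rewrite ge0_integralE//=; apply: ge_ereal_sup => _ [h hf <-].
rewrite -integralT_nnsfun (ge0_negligible_integral mN)//; last 2 first.
- by apply/measurable_EFinP; exact: measurable_funP.
- by move=> x _; rewrite lee_fin.
rewrite integral_mkcond [leRHS]integral_mkcond; apply: ge0_le_lower_integral.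
  by move=> x _; rewrite patchE; case: ifPn => // _; rewrite lee_fin.
move=> x _; rewrite !patchE; case: ifPn => [/set_mem [_ Nx]|_]; last first.
  by case: ifPn => // /set_mem /g0.
have := hf x; rewrite patchE; case: ifPn => // /set_mem Dx hx.
apply: le_trans hx _; apply: contrapT => fg; apply: Nx; apply: subN => /= fgx.
exact/fg/fgx.
Qed.

Lemma ge0_ae_eq_lower_integral D (f g : T -> \bar R) :
  (forall x, D x -> 0 <= f x)%E -> (forall x, D x -> 0 <= g x)%E ->
  ae_eq mu D f g -> (\int[mu]_(x in D) f x = \int[mu]_(x in D) g x)%E.
Proof.
move=> f0 g0 fg; apply/le_anti/andP; split; apply: ge0_ae_le_lower_integral => //.
  by apply: filterS fg => x H Dx; rewrite H.
by apply: filterS fg => x H Dx; rewrite H.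
Qed.

Lemma ge0_subset_lower_integral D E (f : T -> \bar R) :
  D `<=` E -> (forall x, E x -> 0 <= f x)%E ->
  (\int[mu]_(x in D) f x <= \int[mu]_(x in E) f x)%E.
Proof.
move=> DE f0; rewrite integral_mkcond [leRHS]integral_mkcond; apply: ge0_le_lower_integral.
  by move=> x _; rewrite patchE; case: ifPn => // /set_mem /DE /f0.
move=> x _; rewrite !patchE; case: ifPn => [/set_mem /DE Ex|_]; first by rewrite mem_set.
by case: ifPn => // /set_mem /f0.
Qed.

Lemma ge0_lower_integralU_le D E (f : T -> \bar R) :
  measurable D -> (forall x, (D `|` E) x -> 0 <= f x)%E ->
  (\int[mu]_(x in D `|` E) f x <= \int[mu]_(x in D) f x + \int[mu]_(x in E) f x)%E.
Proof.
move=> mD f0; rewrite [leLHS]ge0_integralE//=; apply: ge_ereal_sup => _ [h hf <-].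
have mh : measurable_fun setT (EFin \o h) by apply/measurable_EFinP; exact: measurable_funP.
have h0 x : (0 <= (h x)%:E)%E by rewrite lee_fin.
rewrite -integralT_nnsfun -(setUv D) ge0_integral_setU//; last 3 first.
- exact: measurableC.
- by rewrite setUv.
- by apply/disj_setPCl.
apply: leeD.
  apply: ge0_le_lower_integral => // x Dx; have := hf x.
  by rewrite patchE mem_set//; left.
rewrite integral_mkcond [leRHS]integral_mkcond; apply: ge0_le_lower_integral.
  by move=> x _; rewrite patchE; case: ifP.
move=> x _; rewrite !patchE; case: ifPn => [/set_mem nD|_]; last first.
  by case: ifPn => // /set_mem Ex; apply: f0; right.
have := hf x; rewrite patchE; case: ifPn => [/set_mem [//|Ex]|nDE].
  by rewrite mem_set.
by case: ifPn => // /set_mem Ex; move: nDE; rewrite notin_setE => -[]; right.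
Qed.

(* A limit of measurable functions that exists only almost everywhere need not be measurable
   when the sigma-algebra is not complete, as for the Lebesgue measure on Borel sets. *)
Definition ae_measurable D (f : T -> R) : Prop :=
  exists2 h : T -> R, measurable_fun setT h & ae_eq mu D f h.

Lemma measurable_ae_measurable D (f : T -> R) : measurable_fun setT f -> ae_measurable D f.
Proof. by move=> mf; exists f => //; exact: aeW. Qed.

Lemma ae_measurable_comp D (phi : R -> R) (f : T -> R) :
  measurable_fun setT phi -> ae_measurable D f -> ae_measurable D (phi \o f).
Proof.
move=> mphi [h mh fh]; exists (phi \o h); first exact: measurableT_comp.
exact: ae_eq_comp.
Qed.

Lemma ae_measurableM D (f g : T -> R) :
  ae_measurable D f -> ae_measurable D g -> ae_measurable D (f \* g).
Proof.
move=> [h mh fh] [k mk gk]; exists (h \* k); first exact: measurable_funM.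
by apply: filterS2 fh gk => x + + Dx => /= -> // ->.
Qed.

Lemma ae_measurableD D (f g : T -> R) :
  ae_measurable D f -> ae_measurable D g -> ae_measurable D (f \+ g).
Proof.
move=> [h mh fh] [k mk gk]; exists (h \+ k); first exact: measurable_funD.
by apply: filterS2 fh gk => x + + Dx => /= -> // ->.
Qed.

Lemma ae_measurable_ge0 D (f : T -> R) : (forall x, D x -> 0 <= f x) -> ae_measurable D f ->
  exists h : T -> R, [/\ measurable_fun setT h, (forall x, 0 <= h x), ae_eq mu D f h &
    forall E, E `<=` D -> (\int[mu]_(x in E) (f x)%:E = \int[mu]_(x in E) (h x)%:E)%E].
Proof.
move=> f0 [h mh fh].
have f_normh : ae_eq mu D f (fun x => `|h x|).
  by apply: filterS fh => x fh Dx; rewrite -fh// ger0_norm// f0.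
exists (fun x => `|h x|); split => //; first exact: measurableT_comp.
move=> E ED; apply: ge0_ae_eq_lower_integral => [x Ex|x Ex|]; rewrite ?lee_fin//.
  by rewrite f0//; exact: ED.
by apply: ae_eq_comp; exact: ae_eq_subset f_normh.
Qed.

Lemma ge0_lower_integralD D (f g : T -> R) : measurable D ->
  (forall x, D x -> 0 <= f x) -> ae_measurable D f ->
  (forall x, D x -> 0 <= g x) -> ae_measurable D g ->
  (\int[mu]_(x in D) (f x + g x)%:E =
   \int[mu]_(x in D) (f x)%:E + \int[mu]_(x in D) (g x)%:E)%E.
Proof.
move=> mD f0 /(ae_measurable_ge0 f0)[h [mh h0 fh ->//]] g0.
move=> /(ae_measurable_ge0 g0)[k [mk k0 gk ->//]].
rewrite -ge0_integralD => [|//|x _||x _|]; rewrite ?lee_fin//; last 2 first.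
- by apply/measurable_EFinP; exact: measurable_funTS.
- by apply/measurable_EFinP; exact: measurable_funTS.
apply: ge0_ae_eq_lower_integral => [x Dx|x Dx|].
- by rewrite lee_fin addr_ge0 ?f0 ?g0.
- by rewrite lee_fin addr_ge0.
- by apply: filterS2 fh gk => x + + Dx => -> // ->.
Qed.

Lemma ge0_lower_integralZl D (c : R) (f : T -> R) : measurable D -> 0 <= c ->
  (forall x, D x -> 0 <= f x) -> ae_measurable D f ->
  (\int[mu]_(x in D) (c * f x)%:E = c%:E * \int[mu]_(x in D) (f x)%:E)%E.
Proof.
move=> mD c0 f0 /(ae_measurable_ge0 f0)[h [mh h0 fh ->//]].
rewrite -ge0_integralZl_EFin => [||x _||]; rewrite ?lee_fin//; last first.
  by apply/measurable_EFinP; exact: measurable_funTS.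
apply: ge0_ae_eq_lower_integral => [x Dx|x Dx|].
- by rewrite lee_fin mulr_ge0 ?f0.
- by rewrite lee_fin mulr_ge0.
- by apply: filterS fh => x + Dx => ->.
Qed.

Lemma ge0_lower_integral_setU D E (f : T -> R) : measurable D -> measurable E ->
  [disjoint D & E] -> (forall x, (D `|` E) x -> 0 <= f x) -> ae_measurable (D `|` E) f ->
  (\int[mu]_(x in D `|` E) (f x)%:E =
   \int[mu]_(x in D) (f x)%:E + \int[mu]_(x in E) (f x)%:E)%E.
Proof.
move=> mD mE DE f0 /(ae_measurable_ge0 f0)[h [mh h0 _ int_f]].
rewrite !int_f//; apply: ge0_integral_setU => //; last by move=> x _; rewrite lee_fin.
by apply/measurable_EFinP; exact: measurable_funTS.
Qed.

Lemma ge0_lower_integral_eq0 D (f : T -> R) : measurable D ->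
  (forall x, D x -> 0 <= f x) -> ae_measurable D f ->
  (\int[mu]_(x in D) (f x)%:E = 0)%E -> {ae mu, forall x, D x -> f x = 0}.
Proof.
move=> mD f0 /(ae_measurable_ge0 f0)[h [mh h0 fh ->//]] int_h0.
have h_eq0 : ae_eq mu D (EFin \o h) (cst 0%E).
  apply/(ae_eq_integral_abs mu mD); first by apply/measurable_EFinP; exact: measurable_funTS.
  by rewrite -[RHS]int_h0; apply: eq_integral => x _ /=; rewrite ger0_norm.
by apply: filterS2 fh h_eq0 => x fh + Dx => /(_ Dx)[]; rewrite fh.
Qed.

Lemma ae_summable_majorant D (h : nat -> T -> R) (C : R) : measurable D -> 0 <= C ->
  (forall n x, D x -> 0 <= h n x) -> (forall n, ae_measurable D (h n)) ->
  (forall n, \int[mu]_(x in D) (h n x)%:E <= (C / (2 ^ n.+1)%:R)%:E)%E ->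
  exists G : T -> R, [/\ forall x, 0 <= G x, measurable_fun setT G,
    (\int[mu]_(x in D) (G x)%:E <= C%:E)%E & {ae mu, forall x, D x -> forall n, h n x <= G x}].
Proof.
move=> mD C0 h0 mh int_h.
have /choice[k k_spec] n := ae_measurable_ge0 (h0 n) (mh n).
have mk n : measurable_fun setT (fun x => (k n x)%:E).
  by apply/measurable_EFinP; have [] := k_spec n.
have k0 n x : (0 <= (k n x)%:E)%E by rewrite lee_fin; have [_ + _] := k_spec n.
pose S x := (\sum_(0 <= n <oo) (k n x)%:E)%E.
have S0 x : (0 <= S x)%E by exact: nneseries_ge0.
have mS : measurable_fun setT S by exact: ge0_emeasurable_sum.
have int_S : (\int[mu]_(x in D) S x <= C%:E)%E.
  rewrite integral_nneseries//; last by move=> n; exact: measurable_funTS.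
  apply: le_trans (epsilon_trick0 xpredT C0); apply: lee_nneseries => [n *|n _].
    exact: integral_ge0.
  by apply: le_trans (int_h n); have [_ _ _ ->] := k_spec n.
have S_fin : {ae mu, forall x, D x -> S x \is a fin_num}.
  apply: integrable_ae => //; apply/integrableP; split; first exact: measurable_funTS.
  by under eq_integral do rewrite gee0_abs//; exact: le_lt_trans int_S (ltry _).
exists (fine \o S); split => [x||| ].
- exact: fine_ge0.
- exact: measurableT_comp.
- apply: le_trans int_S; apply: ge0_ae_le_lower_integral => //.
    by move=> x _; rewrite lee_fin fine_ge0.
  by apply: filterS S_fin => x Sx Dx /=; rewrite fineK// Sx.
- have hk : {ae mu, forall x, forall n, D x -> h n x = k n x}.
    by apply: ae_foralln => n; have [] := k_spec n.
  apply: filterS2 S_fin hk => x Sx hk Dx n; rewrite hk// -lee_fin fineK; last exact: Sx.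
  apply: le_trans (nneseries_lim_ge n.+1 _); last by move=> *; exact: k0.
  by rewrite big_nat_recr//= leeDr// sume_ge0.
Qed.

End lower_integral.

(** * Step functions *)

HB.instance Definition _ (R : realType) := Measure.copy (@leb R) (@lebesgue_measure R).

Instance leb_ae_filter (R : realType) : Filter (almost_everywhere (@leb R)).
Proof. exact: ae_filter_ringOfSetsType. Qed.

Section step_functions.
Context {R : realType} {X : normedModType R}.
Implicit Types (D E : set R) (s : step X).

Definition step_add s s' : step X :=
  Step (st_n s + st_n s')
    (fun i => if (i < st_n s)%N then st_A s i else st_A s' (i - st_n s))
    (fun i => if (i < st_n s)%N then st_x s i else st_x s' (i - st_n s)).

Definition step_map (Y : normedModType R) (phi : X -> Y) s : step Y :=
  Step (st_n s) (st_A s) (phi \o st_x s).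

Definition step_sub s s' : step X := step_add s (Step (st_n s') (st_A s') (-%R \o st_x s')).

Definition step_restr E s : step X := Step (st_n s) (fun i => st_A s i `&` E) (st_x s).

Lemma step_meas_add s s' : step_meas s -> step_meas s' -> step_meas (step_add s s').
Proof. by move=> ms ms' i /=; case: ifP. Qed.

Lemma step_meas_sub s s' : step_meas s -> step_meas s' -> step_meas (step_sub s s').
Proof. by move=> ms ms'; apply: step_meas_add => // i; exact: ms'. Qed.

Lemma step_fun_add s s' (t : R) : step_fun (step_add s s') t = step_fun s t + step_fun s' t.
Proof.
rewrite /step_fun /= big_split_ord /=; congr (_ + _); apply: eq_bigr => i _ /=.
  by rewrite ltn_ord.
by rewrite ltnNge leq_addr /= addKn.
Qed.

Lemma step_int_add D s s' : step_int D (step_add s s') = step_int D s + step_int D s'.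
Proof.
rewrite /step_int /= big_split_ord /=; congr (_ + _); apply: eq_bigr => i _ /=.
  by rewrite ltn_ord.
by rewrite ltnNge leq_addr /= addKn.
Qed.

Lemma step_fun_map (Y : normedModType R) (phi : {linear X -> Y}) s (t : R) :
  step_fun (step_map phi s) t = phi (step_fun s t).
Proof. by rewrite /step_fun linear_sum; apply: eq_bigr => i _; rewrite linearZ. Qed.

Lemma step_fun_sub s s' (t : R) : step_fun (step_sub s s') t = step_fun s t - step_fun s' t.
Proof.
rewrite step_fun_add /step_fun -sumrN; congr (_ + _).
by apply: eq_bigr => i _ /=; rewrite scalerN.
Qed.

Lemma step_int_sub D s s' : step_int D (step_sub s s') = step_int D s - step_int D s'.
Proof.
rewrite step_int_add /step_int -sumrN; congr (_ + _).
by apply: eq_bigr => i _ /=; rewrite scalerN.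
Qed.

Lemma step_fun_restr E s (t : R) : step_fun (step_restr E s) t = \1_E t *: step_fun s t.
Proof.
rewrite /step_fun scaler_sumr; apply: eq_bigr => i _ /=.
by rewrite indicI /= mulrC scalerA.
Qed.

Lemma step_fun_recr (n : nat) (A : nat -> set R) (x : nat -> X) (t : R) :
  step_fun (Step n.+1 A x) t = step_fun (Step n A x) t + \1_(A n) t *: x n.
Proof. by rewrite /step_fun /= big_ord_recr. Qed.

Lemma step_int_recr (n : nat) (A : nat -> set R) (x : nat -> X) D :
  step_int D (Step n.+1 A x) = step_int D (Step n A x) + fine (leb (A n `&` D)) *: x n.
Proof. by rewrite /step_int /= big_ord_recr. Qed.

Lemma measurable_step_fun_pred s (P : X -> Prop) :
  step_meas s -> measurable [set t | P (step_fun s t)].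
Proof.
case: s => n A x; rewrite /step_meas /= => mA; elim: n P => [|n IH] P.
  rewrite (_ : [set _ | _] = [set _ | P 0]); last first.
    by apply/seteqP; split => t /=; rewrite /step_fun big_ord0.
  have [P0|P0] := pselect (P 0); first by rewrite (_ : [set _ | _] = setT)//; apply/seteqP; split.
  by rewrite (_ : [set _ | _] = set0)//; apply/seteqP; split.
rewrite (_ : [set _ | _] =
  (A n `&` [set t | P (step_fun (Step n A x) t + x n)]) `|`
  (~` A n `&` [set t | P (step_fun (Step n A x) t)])).
  apply: measurableU; apply: measurableI; try exact: mA.
  - exact: (IH (fun y => P (y + x n))).
  - by apply: measurableC; exact: mA.
  - exact: IH.
apply/seteqP; split => t /=; rewrite step_fun_recr indicE.
  by have [At|At] := pselect (A n t);
    [rewrite mem_set// scale1r; left|rewrite memNset// scale0r addr0; right].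
by case=> -[At]; [rewrite mem_set// scale1r|rewrite memNset// scale0r addr0].
Qed.

Lemma measurable_fun_comp_step s (phi : X -> R) :
  step_meas s -> measurable_fun setT (fun t => phi (step_fun s t)).
Proof. by move=> ms _ Y mY; rewrite setTI; exact: (measurable_step_fun_pred (Y \o phi) ms). Qed.

Lemma step_integrable_fin D s :
  step_meas s -> measurable D -> (leb D < +oo)%E -> step_integrable D s.
Proof.
move=> ms mD D0; split => // i _; apply: le_lt_trans D0.
by apply: le_measure; rewrite ?inE//; apply: measurableI => //; exact: ms.
Qed.

Lemma step_integrable_subset D E s : D `<=` E -> measurable D -> measurable E ->
  step_integrable E s -> step_integrable D s.
Proof.
move=> DE mD mE [ms sE]; split => // i /sE; apply: le_lt_trans.
apply: le_measure; rewrite ?inE; last exact: setIS.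
- exact: measurableI (ms i) mD.
- exact: measurableI (ms i) mE.
Qed.

Lemma step_integrable_sub D s s' :
  step_integrable D s -> step_integrable D s' -> step_integrable D (step_sub s s').
Proof.
move=> [ms sD] [ms' s'D]; split; first exact: step_meas_sub.
move=> i /= ilt; case: ifPn => [|ni]; first exact: sD.
by apply: s'D; rewrite ltn_subLR// leqNgt.
Qed.

Lemma step_int_setU D E s : measurable D -> measurable E -> D `&` E = set0 ->
  step_integrable D s -> step_integrable E s ->
  step_int (D `|` E) s = step_int D s + step_int E s.
Proof.
move=> mD mE DE [ms sD] [_ sE]; rewrite /step_int -big_split /=; apply: eq_bigr => i _.
rewrite -scalerDl -fineD ?ge0_fin_numE ?measure_ge0 ?sD ?sE ?ltn_ord//.
congr (fine _ *: _); rewrite setIUr measureU//.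
- exact: measurableI (ms i) mD.
- exact: measurableI (ms i) mE.
- by rewrite setIACA setIid DE setI0.
Qed.

(* Induction on the number of sets, splitting [E] along the last one: the sets of a
   [step] may overlap, so the values of [step_fun] are not directly the [st_x s i]. *)
Lemma norm_cst_step_int_le s (y : X) E : step_meas s -> measurable E -> (leb E < +oo)%E ->
  ((`|fine (leb E) *: y + step_int E s|)%:E <= \int[@leb R]_(t in E) (`|y + step_fun s t|)%:E)%E.
Proof.
case: s => n A x; rewrite /step_meas /= => mA; elim: n y E => [|n IH] y E mE E0.
  rewrite /step_int big_ord0 addr0; under eq_integral do rewrite /step_fun big_ord0 addr0.
  rewrite integral_cst// normrZ mulrC EFinM ger0_norm ?fine_ge0 ?measure_ge0//.
  by rewrite fineK// ge0_fin_numE ?measure_ge0.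
have mAn : measurable (A n) by exact: mA.
have mE_in : measurable (E `&` A n) by exact: measurableI.
have mE_out : measurable (E `\` A n) by exact: measurableD.
have E_in_fin : (leb (E `&` A n) < +oo)%E.
  by apply: le_lt_trans E0; apply: le_measure; rewrite ?inE.
have E_out_fin : (leb (E `\` A n) < +oo)%E.
  by apply: le_lt_trans E0; apply: le_measure; rewrite ?inE.
have E_disj : (E `&` A n) `&` (E `\` A n) = set0 by rewrite setDE setIACA setICr setI0.
have split_E : fine (leb E) *: y + step_int E (Step n.+1 A x) =
    (fine (leb (E `&` A n)) *: (y + x n) + step_int (E `&` A n) (Step n A x)) +
    (fine (leb (E `\` A n)) *: y + step_int (E `\` A n) (Step n A x)).
  rewrite step_int_recr (setIC (A n)) -{1 2}(setUIDK E (A n)) measureU//.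
  rewrite fineD ?ge0_fin_numE ?measure_ge0// step_int_setU//; try exact: step_integrable_fin.
  by rewrite scalerDl scalerDr [LHS](AC (2*(2*1)) ((1*5*3)*(2*4))).
rewrite split_E -[in leRHS](setUIDK E (A n)) ge0_lower_integral_setU//; last 2 first.
- exact/disj_set2P.
- apply/measurable_ae_measurable.
  exact: (@measurable_fun_comp_step (Step n.+1 A x) (fun z => `|y + z|)).
have le_sum := leeD (IH (y + x n) _ mE_in E_in_fin) (IH y _ mE_out E_out_fin).
rewrite -EFinD in le_sum.
apply: le_trans (le_trans le_sum _); first by rewrite lee_fin ler_normD.
apply: leeD; apply: ge0_le_lower_integral => [t _|t [_ At]]; rewrite ?lee_fin//.
  by rewrite step_fun_recr indicE mem_set// scale1r addrAC addrA.
by rewrite step_fun_recr indicE memNset// scale0r addr0.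
Qed.

Lemma norm_step_int_le D s : measurable D -> step_integrable D s ->
  ((`|step_int D s|)%:E <= \int[@leb R]_(t in D) (`|step_fun s t|)%:E)%E.
Proof.
move=> mD [ms sD]; pose AD i := st_A s i `&` D; pose E := \big[setU/set0]_(i < st_n s) AD i.
have mAD i : measurable (AD i) by exact: measurableI (ms i) mD.
have mE : measurable E by exact: bigsetU_measurable.
have ED : E `<=` D by rewrite /E -bigcup_mkord => t [i _ []].
have E_fin : (leb E < +oo)%E.
  apply: le_lt_trans (@Boole_inequality _ _ _ (@leb R) AD (st_n s) (fun i _ => mAD i)) _.
  by apply/lte_sum_pinfty => i _; exact: sD.
have -> : step_int D s = step_int E s.
  apply: eq_bigr => i _; congr (fine (leb _) *: _); apply/seteqP; split => t [At Et].
    by split => //; rewrite /E -bigcup_mkord; exists i => /=.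
  by split => //; exact: ED.
have := norm_cst_step_int_le 0 ms mE E_fin; rewrite scaler0 add0r => /le_trans; apply.
under eq_integral do rewrite add0r.
by apply: ge0_subset_lower_integral => // t _; rewrite lee_fin.
Qed.

End step_functions.

(** * Strongly measurable functions *)

Section strongly_measurable.
Context {R : realType} {X : normedModType R}.
Implicit Types (D E : set R) (f g : R -> X).

Lemma strongly_meas_subset D E f : D `<=` E -> strongly_meas E f -> strongly_meas D f.
Proof. by move=> DE [s [ms sf]]; exists s; split => //; apply: filterS sf => t H /DE /H. Qed.

Lemma strongly_meas_step D (s : step X) : step_meas s -> strongly_meas D (step_fun s).
Proof. by move=> ms; exists (fun=> s); split => //; apply: aeW => t _; exact: cvg_cst. Qed.

Lemma strongly_meas0 D : strongly_meas D (fun=> 0 : X).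
Proof.
have -> : (fun=> 0) = step_fun (Step 0 (fun=> set0) (fun=> 0 : X)).
  by apply/funext => t; rewrite /step_fun big_ord0.
by apply: strongly_meas_step => i; exact: measurable0.
Qed.

Lemma strongly_measD D f g :
  strongly_meas D f -> strongly_meas D g -> strongly_meas D (fun t => f t + g t).
Proof.
move=> [s [ms sf]] [s' [ms' sg]]; exists (fun n => step_add (s n) (s' n)); split.
  by move=> n; exact: step_meas_add.
apply: filterS2 sf sg => t sf sg Dt; under eq_fun do rewrite step_fun_add.
by apply: cvgD; [exact: sf|exact: sg].
Qed.

Lemma strongly_meas_linear (Y : normedModType R) (phi : {linear X -> Y}) D f :
  continuous phi -> strongly_meas D f -> strongly_meas D (fun t => phi (f t)).
Proof.
move=> cphi [s [ms sf]]; exists (fun n => step_map phi (s n)); split.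
  by move=> n i; exact: ms.
apply: filterS sf => t sf Dt; under eq_fun do rewrite step_fun_map.
by apply: (@cvg_comp _ _ _ (fun n => step_fun (s n) t) phi); [exact: sf|exact: cphi].
Qed.

Lemma strongly_meas_indic D E f : measurable E ->
  strongly_meas (D `&` E) f -> strongly_meas D (fun t => \1_E t *: f t).
Proof.
move=> mE [s [ms sf]]; exists (fun n => step_restr E (s n)); split.
  by move=> n i; apply: measurableI => //; exact: ms.
apply: filterS sf => t sf Dt; under eq_fun do rewrite step_fun_restr.
rewrite indicE; have [Et|Et] := pselect (E t).
  by rewrite mem_set// scale1r; under eq_fun do rewrite scale1r; exact: sf.
by rewrite memNset// scale0r; under eq_fun do rewrite scale0r; exact: cvg_cst.
Qed.

Lemma ae_measurable_norm D f : strongly_meas D f -> ae_measurable (@leb R) D (fun t => `|f t|).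
Proof.
move=> [s [ms sf]]; exists (fun t => fine (limn_esup (fun n => (`|step_fun (s n) t|)%:E))).
  apply: (measurableT_comp (fine_measurable _)) => //.
  apply: measurable_fun_limn_esup => n; apply/measurable_EFinP.
  exact: (measurable_fun_comp_step (fun x => `|x|)).
apply: filterS sf => t sf Dt.
have /cvg_limn_einf_sup[_ ->//] : (fun n => (`|step_fun (s n) t|)%:E) @ \oo --> (`|f t|)%:E.
by apply: cvg_EFin; [exact: nearW|apply: cvg_norm; exact: sf].
Qed.

End strongly_measurable.

Section strongly_measurable_limit.
Context {R : realType} {X : normedModType R}.
Implicit Types (D E : set R) (f g : R -> X).

Lemma strongly_measN D f : strongly_meas D f -> strongly_meas D (fun t => - f t).
Proof. exact: (@strongly_meas_linear _ _ _ (-%R : {linear X -> X}) D f opp_continuous). Qed.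

Lemma strongly_measB D f g :
  strongly_meas D f -> strongly_meas D g -> strongly_meas D (fun t => f t - g t).
Proof. by move=> sf sg; apply: strongly_measD => //; exact: strongly_measN. Qed.

Lemma strongly_meas_almost_uniform D f (e : R) : measurable D -> (leb D < +oo)%E -> 0 < e ->
  strongly_meas D f -> exists (s : step X) (E : set R), [/\ step_meas s, measurable E,
    (leb E <= e%:E)%E & {ae @leb R, forall t, D t -> ~ E t -> `|step_fun s t - f t| <= e}].
Proof.
move=> mD D_fin e0 smf; have [s [ms sf]] := smf.
have dist_ae n : ae_measurable (@leb R) D (fun t => `|step_fun (s n) t - f t|).
  by apply/ae_measurable_norm/strongly_measB => //; exact: strongly_meas_step.
have /choice[h h_spec] n := ae_measurable_ge0 (fun _ _ => normr_ge0 _) (dist_ae n).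
have mh n : measurable_fun D (h n) by apply: measurable_funTS; have [] := h_spec n.
have h_dist : {ae @leb R, forall t, forall n, D t -> `|step_fun (s n) t - f t| = h n t}.
  by apply: ae_foralln => n; have [] := h_spec n.
have h_cvg : {ae @leb R, forall t, D t -> h n t @[n --> \oo] --> (cst 0 t : R)}.
  apply: filterS2 sf h_dist => t sf h_dist Dt.
  have -> : (fun n => h n t) = (fun n => `|step_fun (s n) t - f t|).
    by apply/funext => n; rewrite h_dist.
  have : (fun n => `|step_fun (s n) t - f t|) @ \oo --> `|f t - f t|.
    by apply: cvg_norm; apply: cvgB; [exact: sf|exact: cvg_cst].
  by rewrite subrr normr0.
have [E [mE Ee h_unif]] :=
  ae_pointwise_almost_uniform (mu := @leb R) mh (@measurable_cst _ _ _ _ _ _) mD D_fin h_cvg e0.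
have : nbhs (cst 0 : {uniform` D `\` E -> R})
    (fun k => forall t : R, (D `\` E) t -> `|k t| <= e).
  apply/uniform_nbhs; exists [set xy | ball xy.1 e xy.2]; split.
    exact: (entourage_ball _ (PosNum e0)).
  by move=> k k_ball t /k_ball; rewrite /= /ball /= sub0r normrN => /ltW.
move/h_unif => [n _ /(_ n (leqnn n))] h_le; exists (s n), E; split => //; first exact: ltW.
apply: filterS h_dist => t h_dist Dt Et; rewrite h_dist// -[leLHS]ger0_norm; first exact: h_le.
by have [_ + _ _] := h_spec n.
Qed.

Lemma strongly_meas_cvg D (f_ : nat -> R -> X) f : measurable D -> (leb D < +oo)%E ->
  (forall n, strongly_meas D (f_ n)) ->
  {ae @leb R, forall t, D t -> (fun n => f_ n t) @ \oo --> f t} -> strongly_meas D f.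
Proof.
move=> mD D_fin sf f_cvg.
have e0 n : 0 < (1 / (2 ^ n.+1)%:R : R) by rewrite divr_gt0 ?ltr0n ?expn_gt0.
have /choice[s /choice[E sE]] n := strongly_meas_almost_uniform mD D_fin (e0 n) (sf n).
have mE n : measurable (E n) by have [] := sE n.
exists s; split => [n|]; first by have [] := sE n.
have E0 : leb (lim_sup_set E) = 0%E.
  apply: lim_sup_set_cvg0 => //; apply: le_lt_trans (ltry 1).
  apply: le_trans (epsilon_trick0 xpredT ler01); apply: lee_nneseries => [n *|n _].
    exact: measure_ge0.
  by have [] := sE n.
have not_E : {ae @leb R, forall t, ~ lim_sup_set E t}.
  exists (lim_sup_set E); split => //; last by move=> t /contrapT.
  by apply: bigcap_measurable => // n _; apply: bigcup_measurable => k _; exact: mE.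
have s_le : {ae @leb R, forall t, forall n, D t -> ~ E n t ->
    `|step_fun (s n) t - f_ n t| <= 1 / (2 ^ n.+1)%:R}.
  by apply: ae_foralln => n; have [] := sE n.
apply: filterS3 f_cvg not_E s_le => t f_cvg not_Et s_le Dt.
have [N not_EN] : exists N, forall n, (N <= n)%N -> ~ E n t.
  apply: contrapT => no_N; apply: not_Et => N _; apply: contrapT => notin_tail; apply: no_N.
  by exists N => n Nn Ent; apply: notin_tail; exists n.
have -> : (fun n => step_fun (s n) t) = (fun n => f_ n t + (step_fun (s n) t - f_ n t)).
  by apply/funext => n; rewrite addrC subrK.
rewrite -(addr0 (f t)); apply: cvgD; first exact: f_cvg.
apply/norm_cvg0P/(@squeeze_cvgr _ _ _ _ (fun=> 0) (fun n => geometric 2^-1 2^-1 n)).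
- exists N => // n /= Nn; rewrite normr_ge0 (le_trans (s_le n Dt (not_EN n Nn)))//.
  by rewrite natrX exprS invfM mul1r exprVn.
- exact: cvg_cst.
- by apply: cvg_geometric; rewrite ger0_norm ?invr_ge0// invf_lt1// ltr1n.
Qed.

End strongly_measurable_limit.

(** * Bochner integrals *)

Lemma cvge0D {R : realType} (u v : nat -> \bar R) :
  u @ \oo --> 0%E -> v @ \oo --> 0%E -> (u \+ v)%E @ \oo --> 0%E.
Proof. by move=> u0 v0; rewrite -[0%E]adde0; exact: cvgeD. Qed.

Section bochner.
Context {R : realType} {X : normedModType R}.
Implicit Types (D E : set R) (f g h : R -> X) (v w : X).

Lemma integral_norm_ge0 D f : (0 <= \int[@leb R]_(t in D) (`|f t|)%:E)%E.
Proof. by apply: integral_ge0 => t _; rewrite lee_fin. Qed.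

Lemma le_integral_normD D f g h : measurable D -> strongly_meas D g -> strongly_meas D h ->
  (forall t, D t -> `|f t| <= `|g t| + `|h t|) ->
  (\int[@leb R]_(t in D) (`|f t|)%:E <=
   \int[@leb R]_(t in D) (`|g t|)%:E + \int[@leb R]_(t in D) (`|h t|)%:E)%E.
Proof.
move=> mD sg sh fgh; rewrite -ge0_lower_integralD//; try exact: ae_measurable_norm.
by apply: ge0_le_lower_integral => t Dt; rewrite lee_fin// fgh.
Qed.

Lemma norm_le_cvge0 (x : nat -> X) (u : nat -> \bar R) :
  u @ \oo --> 0%E -> (forall n, (`|x n|)%:E <= u n)%E -> x @ \oo --> 0.
Proof.
move=> u0 xu; apply/norm_cvg0P; apply: (@fine_cvg _ _ _ _ (fun n => (`|x n|)%:E)).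
by apply: (squeeze_cvge _ (cvg_cst 0%E) u0); apply: nearW => n; rewrite lee_fin normr_ge0 xu.
Qed.

Lemma step_int_sub_cvg0 D g (s s' : nat -> step X) : measurable D -> strongly_meas D g ->
  (forall n, step_integrable D (s n)) -> (forall n, step_integrable D (s' n)) ->
  (\int[@leb R]_(t in D) (`|step_fun (s n) t - g t|)%:E)%E @[n --> \oo] --> 0%E ->
  (\int[@leb R]_(t in D) (`|step_fun (s' n) t - g t|)%:E)%E @[n --> \oo] --> 0%E ->
  step_int D (s n) - step_int D (s' n) @[n --> \oo] --> 0.
Proof.
move=> mD smg si si' sg s'g.
apply: (norm_le_cvge0 (cvge0D sg s'g)) => n; rewrite -step_int_sub.
apply: le_trans (norm_step_int_le mD (step_integrable_sub (si n) (si' n))) _.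
apply: le_integral_normD => //.
- by apply: strongly_measB smg; apply: strongly_meas_step; have [] := si n.
- by apply: strongly_measB smg; apply: strongly_meas_step; have [] := si' n.
- by move=> t _; rewrite step_fun_sub -(subrKA (g t)) -[g t - _]opprB ler_normB.
Qed.

Lemma is_bochner_cvg D g v (s : nat -> step X) : measurable D -> is_bochner D g v ->
  (forall n, step_integrable D (s n)) ->
  (\int[@leb R]_(t in D) (`|step_fun (s n) t - g t|)%:E)%E @[n --> \oo] --> 0%E ->
  step_int D (s n) @[n --> \oo] --> v.
Proof.
move=> mD [smg [s' [si' [s'g s'v]]]] si sg.
rewrite -[v]add0r; under eq_fun => n do rewrite -(subrK (step_int D (s' n)) (step_int D (s n))).
exact: cvgD (step_int_sub_cvg0 mD smg si si' sg s'g) s'v.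
Qed.

Lemma is_bochner_setD D E g v w : measurable D -> measurable E -> D `&` E = set0 ->
  is_bochner (D `|` E) g v -> is_bochner D g w -> is_bochner E g (v - w).
Proof.
move=> mD mE DE [smg [s [si [sg sv]]]] Dgw.
have mDE : measurable (D `|` E) by exact: measurableU.
have sub A : A `<=` D `|` E -> measurable A -> (forall n, step_integrable A (s n)) /\
    (\int[@leb R]_(t in A) (`|step_fun (s n) t - g t|)%:E)%E @[n --> \oo] --> 0%E.
  move=> AD mA; split=> [n|]; first exact: step_integrable_subset (si n).
  apply: (squeeze_cvge _ (cvg_cst 0%E) sg); apply: nearW => n; rewrite integral_norm_ge0 /=.
  by apply: ge0_subset_lower_integral => // t _; rewrite lee_fin.
have [siD sgD] := sub D (@subsetUl _ D E) mD; have [siE sgE] := sub E (@subsetUr _ D E) mE.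
split; first by apply: strongly_meas_subset smg; exact: subsetUr.
exists s; split => //; split => //.
have step_intE n : step_int E (s n) = step_int (D `|` E) (s n) - step_int D (s n).
  by rewrite step_int_setU// addrC addKr.
by under eq_fun do rewrite step_intE; exact: cvgB sv (is_bochner_cvg mD Dgw siD sgD).
Qed.

Lemma is_bochner_norm_le D g v : measurable D -> is_bochner D g v ->
  ((`|v|)%:E <= \int[@leb R]_(t in D) (`|g t|)%:E)%E.
Proof.
move=> mD [smg [s [si [sg sv]]]]; set G := (X in (_ <= X)%E).
have [->|G_fin] := eqVneq G +oo%E; first exact: leey.
have {}G_fin : G \is a fin_num by rewrite ge0_fin_numE ?integral_norm_ge0// ltey.
have norm_sv : (`|step_int D (s n)|)%:E @[n --> \oo] --> (`|v|)%:E.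
  by apply: cvg_EFin; [exact: nearW|exact: cvg_norm].
have bound_G : (\int[@leb R]_(t in D) (`|step_fun (s n) t - g t|)%:E + G)%E @[n --> \oo] --> G.
  by rewrite -[X in _ --> X]add0e; exact: cvgeD (fin_num_adde_defl _ G_fin) sg (cvg_cst G).
apply: (lee_cvg_to norm_sv bound_G); apply: nearW => n.
apply: le_trans (norm_step_int_le mD (si n)) _.
apply: le_integral_normD => //.
  by apply: strongly_measB smg; apply: strongly_meas_step; have [] := si n.
by move=> t _; rewrite -{1}(subrK (g t) (step_fun (s n) t)) ler_normD.
Qed.

Lemma is_bochnerB D f g v w : measurable D -> is_bochner D f v -> is_bochner D g w ->
  is_bochner D (fun t => f t - g t) (v - w).
Proof.
move=> mD [smf [s [si [sf sv]]]] [smg [s' [si' [sg sw]]]]; split; first exact: strongly_measB.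
exists (fun n => step_sub (s n) (s' n)); split; [|split].
- by move=> n; exact: step_integrable_sub.
- apply: (squeeze_cvge _ (cvg_cst 0%E) (cvge0D sf sg)); apply: nearW => n.
  rewrite integral_norm_ge0 /=; apply: le_integral_normD => //.
  + by apply: strongly_measB smf; apply: strongly_meas_step; have [] := si n.
  + by apply: strongly_measB smg; apply: strongly_meas_step; have [] := si' n.
  + move=> t _; rewrite step_fun_sub.
    have -> : step_fun (s n) t - step_fun (s' n) t - (f t - g t) =
        (step_fun (s n) t - f t) - (step_fun (s' n) t - g t).
      by rewrite !opprD !opprK [LHS](AC (2*2) ((1*3)*(2*4))).
    exact: ler_normB.
- by under eq_fun do rewrite step_int_sub; exact: cvgB.
Qed.

End bochner.

(** * Weighted spaces *)

Lemma subset_itvoo_r {R : realType} (a b c : R) : c <= b -> `]a, c[ `<=` `]a, b[.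
Proof. by move=> cb t /=; rewrite !in_itv /= => /andP[-> /lt_le_trans]; apply. Qed.

Lemma powR_invK {R : realType} (x p : R) : 0 <= x -> 0 < p -> (x `^ p) `^ p^-1 = x.
Proof. by move=> x0 p0; rewrite -powRrM mulfV ?powRr1// gt_eqF. Qed.

Lemma ae_neq {R : realType} (x : R) : {ae @leb R, forall t, t != x}.
Proof.
exists [set x]; split; [exact: measurable_set1|exact: lebesgue_measure_set1|].
by move=> t /= /negP; rewrite negbK => /eqP.
Qed.

Section weighted_spaces.
Context {R : realType} {X : normedModType R}.
Variables p kappa : R.
Implicit Types (a b c t : R) (f g : R -> X).

Lemma powR_normD_le (x y : X) : 0 <= p -> `|x + y| `^ p <= 2 `^ p * (`|x| `^ p + `|y| `^ p).
Proof.
move=> p0.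
have larger (u v : X) : `|u| <= `|v| -> `|u + v| `^ p <= 2 `^ p * `|v| `^ p.
  move=> uv; rewrite -powRM//; apply: ge0_ler_powR => //; rewrite ?nnegrE ?mulr_ge0//.
  by apply: le_trans (ler_normD _ _) _; rewrite mulr_natl mulr2n lerD2r.
have [xy|/ltW yx] := leP `|x| `|y|.
  by apply: le_trans (larger _ _ xy) _; rewrite ler_wpM2l ?powR_ge0// lerDr powR_ge0.
by rewrite addrC; apply: le_trans (larger _ _ yx) _; rewrite ler_wpM2l ?powR_ge0// lerDl powR_ge0.
Qed.

Lemma wLp_integrand_ge0 f t : 0 <= `|t| `^ kappa * `|f t| `^ p.
Proof. by rewrite mulr_ge0 ?powR_ge0. Qed.
#[local] Hint Resolve wLp_integrand_ge0 : core.

Lemma ae_measurable_wLp (D : set R) f :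
  strongly_meas D f -> ae_measurable (@leb R) D (fun t => `|t| `^ kappa * `|f t| `^ p).
Proof.
move=> sf; apply: ae_measurableM.
  apply: measurable_ae_measurable; apply: (measurableT_comp (measurable_powR kappa)).
  exact: normr_measurable.
exact: (ae_measurable_comp (measurable_powR p) (ae_measurable_norm sf)).
Qed.

Lemma wLp_int_ge0 a b f : (0 <= wLp_int p kappa a b f)%E.
Proof. by apply: integral_ge0 => t _; rewrite lee_fin. Qed.

Lemma wLp_int_fin_num a b f : wLp p kappa a b f -> wLp_int p kappa a b f \is a fin_num.
Proof. by case=> _; rewrite ge0_fin_numE// wLp_int_ge0. Qed.

Lemma wLp_int_subitv_le a b c f : c <= b -> (wLp_int p kappa a c f <= wLp_int p kappa a b f)%E.
Proof.
move=> cb; apply: ge0_subset_lower_integral; first exact: subset_itvoo_r.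
by move=> t _; rewrite lee_fin.
Qed.

Lemma ae_eq_wLp_int a b f g : {ae @leb R, forall t, `]a, b[%classic t -> f t = g t} ->
  wLp_int p kappa a b f = wLp_int p kappa a b g.
Proof.
move=> fg; apply: ge0_ae_eq_lower_integral => [t _|t _|]; rewrite ?lee_fin//.
by apply: filterS fg => t + tab => ->.
Qed.

Lemma eq_wLp_int a b f g : f =1 g -> wLp_int p kappa a b f = wLp_int p kappa a b g.
Proof. by move=> /funext ->. Qed.

Lemma wLp_intD_le a b f g : 0 <= p ->
  strongly_meas `]a, b[%classic f -> strongly_meas `]a, b[%classic g ->
  (wLp_int p kappa a b (fun t => f t + g t)%R <=
   (2 `^ p)%:E * (wLp_int p kappa a b f + wLp_int p kappa a b g))%E.
Proof.
move=> p0 sf sg; have mI : measurable (`]a, b[%classic : set R) by exact: measurable_itv.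
rewrite /wLp_int -ge0_lower_integralD//; try exact: ae_measurable_wLp.
rewrite -ge0_lower_integralZl ?powR_ge0//; last first.
  by apply: ae_measurableD; exact: ae_measurable_wLp.
apply: ge0_le_lower_integral => t _; rewrite lee_fin; first exact: (wLp_integrand_ge0 (f \+ g)).
by rewrite -mulrDr mulrCA ler_wpM2l ?powR_ge0// powR_normD_le.
Qed.

Lemma wLp_intN a b f : wLp_int p kappa a b (fun t => - f t) = wLp_int p kappa a b f.
Proof. by apply: eq_integral => t _; rewrite normrN. Qed.

Lemma wLp_int0 a b : 0 < p -> wLp_int p kappa a b (fun=> 0 : X) = 0%E.
Proof.
move=> p0; rewrite /wLp_int; under eq_integral do rewrite normr0 powR0 ?gt_eqF// mulr0.
exact: integral0.
Qed.

Lemma wLp_int_eq0 a b f : 0 < p -> strongly_meas `]a, b[%classic f ->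
  wLp_int p kappa a b f = 0%E -> {ae @leb R, forall t, `]a, b[%classic t -> f t = 0}.
Proof.
move=> p0 sf int_f0; have mI : measurable (`]a, b[%classic : set R) by exact: measurable_itv.
have f0 := @ge0_lower_integral_eq0 _ _ _ (@leb R) _ _ mI (fun t _ => wLp_integrand_ge0 f t)
  (ae_measurable_wLp sf) int_f0.
apply: filterS2 (ae_neq 0) f0 => t tn0 f0 /f0 /eqP.
rewrite mulf_eq0 !powR_eq0 !normr_eq0 (negPf tn0) (gt_eqF p0) /=.
by rewrite andbT => /eqP.
Qed.

Lemma wLp0 a b : 0 < p -> wLp p kappa a b (fun=> 0 : X).
Proof. by move=> p0; split; [exact: strongly_meas0|rewrite wLp_int0]. Qed.

Lemma wLpD a b f g : 0 <= p ->
  wLp p kappa a b f -> wLp p kappa a b g -> wLp p kappa a b (fun t => f t + g t).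
Proof.
move=> p0 [sf f_fin] [sg g_fin]; split; first exact: strongly_measD.
apply: le_lt_trans (wLp_intD_le p0 sf sg) _.
by apply: lte_mul_pinfty; [rewrite lee_fin powR_ge0|by []|exact: (lte_add_pinfty f_fin g_fin)].
Qed.

Lemma wLpN a b f : wLp p kappa a b f -> wLp p kappa a b (fun t => - f t).
Proof. by case=> sf f_fin; split; [exact: strongly_measN|rewrite wLp_intN]. Qed.

Lemma wLpB a b f g : 0 <= p ->
  wLp p kappa a b f -> wLp p kappa a b g -> wLp p kappa a b (fun t => f t - g t).
Proof. by move=> p0 wf wg; exact: wLpD (wLpN wg). Qed.

Lemma wLp_subitv a b c f : c <= b -> wLp p kappa a b f -> wLp p kappa a c f.
Proof.
move=> cb [sf f_fin]; split; first by apply: strongly_meas_subset sf; exact: subset_itvoo_r.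
exact: le_lt_trans (wLp_int_subitv_le _ _ cb) f_fin.
Qed.

Lemma wLp_int_indic a b c f : 0 < p -> c <= b ->
  wLp_int p kappa a b (fun t => \1_`]a, c[ t *: f t) = wLp_int p kappa a c f.
Proof.
move=> p0 cb; rewrite /wLp_int integral_mkcond [RHS]integral_mkcond; apply: eq_integral => t _.
rewrite !patchE indicE; have [tc|tc] := pselect (`]a, c[%classic t).
  by rewrite !mem_set ?scale1r//; exact: subset_itvoo_r tc.
by rewrite (memNset tc) scale0r normr0 powR0 ?gt_eqF// mulr0; case: ifP.
Qed.

Lemma wLp_indic a b c f : 0 < p -> c <= b ->
  wLp p kappa a c f -> wLp p kappa a b (fun t => \1_`]a, c[ t *: f t).
Proof.
move=> p0 cb [sf f_fin]; split; last by rewrite wLp_int_indic.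
apply: strongly_meas_indic; first exact: measurable_itv.
by apply: strongly_meas_subset sf; exact: subIsetr.
Qed.

Lemma is_deriv_subitv a b c (u g : R -> X) (x : X) :
  c <= b -> is_deriv p kappa a b u g x -> is_deriv p kappa a c u g x.
Proof.
move=> cb [wg ug]; split; first exact: wLp_subitv wg.
by apply: filterS ug => t ug tc; apply: ug; exact: subset_itvoo_r tc.
Qed.

Lemma is_derivB a b (u v g h : R -> X) (x y : X) : 0 <= p ->
  is_deriv p kappa a b u g x -> is_deriv p kappa a b v h y ->
  is_deriv p kappa a b (fun t => u t - v t) (fun t => g t - h t) (x - y).
Proof.
move=> p0 [wg ug] [wh vh]; split; first exact: wLpB.
apply: filterS2 ug vh => t ug vh tab.
rewrite (_ : _ - _ = (u t - x) - (v t - y)); first exact: is_bochnerB (ug tab) (vh tab).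
by rewrite !opprD !opprK [LHS](AC (2*2) ((1*3)*(2*4))).
Qed.

End weighted_spaces.

Section weighted_norm.
Context {R : realType}.
Variables (p kappa a b : R).
Hypothesis p_gt0 : 0 < p.

Lemma powR_wLp_norm (X : normedModType R) (f : R -> X) : wLp p kappa a b f ->
  (wLp_norm p kappa a b f `^ p)%:E = wLp_int p kappa a b f.
Proof.
move=> wf; rewrite /wLp_norm -powRrM mulVf ?gt_eqF// powRr1 ?fineK ?wLp_int_fin_num//.
exact/fine_ge0/wLp_int_ge0.
Qed.

Lemma wLp_norm_leE (X Y : normedModType R) (K : R) (f : R -> X) (g : R -> Y) : 0 <= K ->
  wLp p kappa a b f -> wLp p kappa a b g ->
  (wLp_norm p kappa a b f <= K * wLp_norm p kappa a b g) =
  (wLp_int p kappa a b f <= (K `^ p)%:E * wLp_int p kappa a b g)%E.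
Proof.
move=> K0 wf wg; rewrite -!powR_wLp_norm// -EFinM lee_fin -powRM ?powR_ge0//.
have [g0|f_gt] := leP; last first.
  by apply/esym/negP/negP; rewrite -ltNge gt0_ltr_powR ?nnegrE ?mulr_ge0 ?powR_ge0.
by apply/esym; rewrite ge0_ler_powR ?nnegrE ?mulr_ge0 ?powR_ge0// ltW.
Qed.

Lemma MR_norm_wLp_int_le (X0 X1 : normedModType R) (J : X1 -> X0) (K : R)
    (u : R -> X1) (g F : R -> X0) : 0 <= K ->
  wLp p kappa a b u -> wLp p kappa a b g -> wLp p kappa a b F ->
  MR_norm J p kappa a b u g <= K * wLp_norm p kappa a b F ->
  (wLp_int p kappa a b u <= (K `^ p)%:E * wLp_int p kappa a b F)%E /\
  (wLp_int p kappa a b g <= (K `^ p)%:E * wLp_int p kappa a b F)%E.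
Proof.
move=> K0 wu wg wF; rewrite /MR_norm ge_max => /andP[u_le W1p_le].
have g_le : wLp_norm p kappa a b g <= K * wLp_norm p kappa a b F.
  apply: le_trans W1p_le; rewrite -[leLHS](powR_invK _ p_gt0) ?powR_ge0//.
  apply: ge0_ler_powR; rewrite ?nnegrE ?invr_ge0 ?(ltW p_gt0) ?powR_ge0 ?addr_ge0 ?powR_ge0//.
  by rewrite lerDr powR_ge0.
have int_le (X : normedModType R) (f : R -> X) : wLp p kappa a b f ->
    wLp_norm p kappa a b f <= K * wLp_norm p kappa a b F ->
    (wLp_int p kappa a b f <= (K `^ p)%:E * wLp_int p kappa a b F)%E.
  by move=> wf; rewrite (wLp_norm_leE K0 wf wF).
exact: (conj (int_le _ u wu u_le) (int_le _ g wg g_le)).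
Qed.

Lemma MR_norm_eq0 (X0 X1 : normedModType R) (J : X1 -> X0) (u : R -> X1) :
  MR J p kappa a b u -> MR_norm_le J p kappa a b u 0 ->
  {ae @leb R, forall t, `]a, b[%classic t -> u t = 0}.
Proof.
move=> [wu [_ [g [c ug]]]] /(_ g c ug); rewrite /MR_norm ge_max => /andP[u_le0 _].
apply: (@wLp_int_eq0 _ _ p kappa a b u p_gt0 wu.1); apply/eqP.
by rewrite -powR_wLp_norm// eqe powR_eq0 (gt_eqF p_gt0) andbT eq_le u_le0 powR_ge0.
Qed.

End weighted_norm.

(** * Maximal regularity *)

Section maximal_regularity.
Context {R : realType} {X0 X1 : normedModType R}.
Variables (J : X1 -> X0) (p kappa : R).
Implicit Types (Aop Bop : R -> X1 -> X0) (u v : R -> X1) (f F : R -> X0) (a b c K : R).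

Lemma MR_subitv a b c u : c <= b -> MR J p kappa a b u -> MR J p kappa a c u.
Proof.
move=> cb [wu [wJu [g [x ug]]]]; split; first exact: wLp_subitv wu.
split; first exact: wLp_subitv wJu.
by exists g, x; exact: is_deriv_subitv ug.
Qed.

Lemma strong_sol_subitv Aop a b c f (x : X0) u :
  c <= b -> strong_sol J Aop a b f x u -> strong_sol J Aop a c f x u.
Proof.
move=> cb [wu [wJu [wAu [g [ug eq_f]]]]].
split; first exact: wLp_subitv wu.
split; first exact: wLp_subitv wJu.
split; first exact: wLp_subitv wAu.
exists g; split; first exact: is_deriv_subitv ug.
by apply: filterS eq_f => t eq_f tc; apply: eq_f; exact: subset_itvoo_r tc.
Qed.

Lemma ae_eq_strong_sol Aop a b f F (x : X0) u :
  {ae @leb R, forall t, `]a, b[%classic t -> f t = F t} ->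
  strong_sol J Aop a b f x u -> strong_sol J Aop a b F x u.
Proof.
move=> fF [wu [wJu [wAu [g [ug eq_f]]]]]; split; first exact: wu.
split; first exact: wJu.
split; first exact: wAu.
exists g; split; first exact: ug.
by apply: filterS2 fF eq_f => t fF eq_f tab; rewrite -(fF tab) (eq_f tab).
Qed.

Lemma strong_solDl Aop Bop a b f (x : X0) u : wLp 1 0 a b (fun t => Bop t (u t)) ->
  strong_sol J (fun t y => Aop t y + Bop t y) a b f x u <->
  strong_sol J Aop a b (fun t => f t - Bop t (u t)) x u.
Proof.
move=> wBu; split=> -[wu [wJu [wAu [g [ug eq_f]]]]];
  (split; [exact: wu|split; [exact: wJu|split]]).
- rewrite (_ : (fun t => _) = (fun t => (Aop t (u t) + Bop t (u t)) - Bop t (u t))).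
    exact: (wLpB ler01 wAu wBu).
  by apply/funext => t; rewrite addrK.
- exists g; split; first exact: ug.
  by apply: filterS eq_f => t eq_f tab; rewrite -(eq_f tab) addrA addrK.
- exact: (wLpD ler01 wAu wBu).
- exists g; split; first exact: ug.
  by apply: filterS eq_f => t eq_f tab; rewrite addrA (eq_f tab) subrK.
Qed.

Lemma MR_est_le Aop a b K K' : K <= K' ->
  MR_est J p kappa Aop a b K -> MR_est J p kappa Aop a b K'.
Proof.
move=> KK' estK f wf tau tauI v Mv Sv g c vg; apply: le_trans (estK f wf tau tauI v Mv Sv g c vg) _.
by rewrite ler_wpM2r// powR_ge0.
Qed.

Lemma MR_est_gt_const Aop a b K : (exists K', MR_est J p kappa Aop a b K') ->
  MR_const J p kappa Aop a b < K -> MR_est J p kappa Aop a b K.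
Proof.
by move=> estP /(inf_lt estP)[K' estK' /ltW K'K]; exact: MR_est_le estK'.
Qed.

Lemma MR_const_le Aop a b K :
  0 <= K -> MR_est J p kappa Aop a b K -> MR_const J p kappa Aop a b <= K.
Proof.
move=> K0 estK; rewrite /MR_const; set S := [set _ | _].
have [lS|nlS] := pselect (has_lbound S); first exact: ge_inf.
by rewrite inf_out// => -[].
Qed.

Lemma MR_est_subitv Aop a b c K : 0 < p -> c <= b ->
  MR_est J p kappa Aop a b K -> MR_est J p kappa Aop a c K.
Proof.
move=> p0 cb estK f wf tau /andP[a_tau tau_c] v Mv Sv g y vg.
pose F t := \1_`]a, c[ t *: f t.
have fF : {ae @leb R, forall t, `]a, tau[%classic t -> f t = F t}.
  apply: aeW => t /(subset_itvoo_r tau_c) tc.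
  by rewrite /F indicE mem_set// scale1r.
have tau_b : a < tau <= b by rewrite a_tau (le_trans tau_c).
have := estK F (wLp_indic p0 cb wf) tau tau_b v Mv (ae_eq_strong_sol fF Sv) g y vg.
by rewrite /wLp_norm (ae_eq_wLp_int p kappa fF).
Qed.

End maximal_regularity.

Section maximal_regularity_linear.
Context {R : realType} {X0 X1 : normedModType R}.
Variables (J : {linear X1 -> X0}) (p kappa a b : R) (Aop : R -> X1 -> X0).
Hypotheses (p_gt0 : 0 < p) (ab : a < b) (Aop_sub : forall t, zmod_morphism (Aop t)).
Implicit Types (u v : R -> X1) (f g : R -> X0).

Lemma MRB u v : MR J p kappa a b u -> MR J p kappa a b v -> MR J p kappa a b (fun t => u t - v t).
Proof.
move=> [wu [wJu [g [x ug]]]] [wv [wJv [h [y vh]]]].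
have J_sub : J \o (fun t => u t - v t) = (fun t => (J \o u) t - (J \o v) t).
  by apply/funext => t /=; rewrite linearB.
split; first exact: (wLpB (ltW p_gt0) wu wv).
rewrite J_sub; split; first exact: (wLpB (ltW p_gt0) wJu wJv).
by exists (fun t => g t - h t), (x - y); exact: (is_derivB (ltW p_gt0) ug vh).
Qed.

Lemma strong_solB f g (x y : X0) u v :
  strong_sol J Aop a b f x u -> strong_sol J Aop a b g y v ->
  strong_sol J Aop a b (fun t => f t - g t) (x - y) (fun t => u t - v t).
Proof.
move=> [wu [wJu [wAu [u' [uu' eq_f]]]]] [wv [wJv [wAv [v' [vv' eq_g]]]]].
have J_sub : J \o (fun t => u t - v t) = (fun t => (J \o u) t - (J \o v) t).
  by apply/funext => t /=; rewrite linearB.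
split; first exact: (wLpB ler01 wu wv).
rewrite J_sub; split; first exact: (wLpB ler01 wJu wJv).
split; first by under eq_fun do rewrite Aop_sub; exact: (wLpB ler01 wAu wAv).
exists (fun t => u' t - v' t); split; first exact: (is_derivB ler01 uu' vv').
apply: filterS2 eq_f eq_g => t eq_f eq_g tab.
by rewrite Aop_sub -eq_f// -eq_g// opprD [LHS](AC (2*2) ((1*3)*(2*4))).
Qed.

Lemma MR_est_unique K f u v : wLp p kappa a b f -> MR_est J p kappa Aop a b K ->
  MR J p kappa a b u -> strong_sol J Aop a b f 0 u ->
  MR J p kappa a b v -> strong_sol J Aop a b f 0 v ->
  {ae @leb R, forall t, `]a, b[%classic t -> v t = u t}.
Proof.
move=> wf estK Mu Su Mv Sv; have := strong_solB Sv Su; rewrite subrr => Svu.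
have ff_eq0 : {ae @leb R, forall t, `]a, b[%classic t -> f t - f t = 0}.
  by apply: aeW => t _; rewrite subrr.
have bb : a < b <= b by rewrite ab lexx.
have := estK _ (wLp0 kappa a b p_gt0) b bb _ (MRB Mv Mu) (ae_eq_strong_sol ff_eq0 Svu).
rewrite /wLp_norm wLp_int0// powR0 ?invr_eq0 ?gt_eqF// mulr0 => /(MR_norm_eq0 p_gt0 (MRB Mv Mu)).
by apply: filterS => t vu tab; apply/eqP; rewrite -subr_eq0 vu.
Qed.

Lemma max_reg_of_est K : MR_est J p kappa Aop a b K ->
  (forall f, wLp p kappa a b f ->
    exists u, MR J p kappa a b u /\ strong_sol J Aop a b f 0 u) ->
  max_reg J p kappa Aop a b.
Proof.
move=> estK sol; split; last by exists K.
move=> f wf; have [u [Mu Su]] := sol f wf; exists u; split; [exact: Mu|split; [exact: Su|]].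
by move=> v Mv Sv; exact: (MR_est_unique wf estK).
Qed.

End maximal_regularity_linear.

(** * A weighted Hoelder inequality *)

Lemma le_add_powR {R : realType} (p a x : R) : 1 <= p -> 0 < a -> 0 <= x ->
  x <= a + a `^ (1 - p) * x `^ p.
Proof.
move=> p1 a0 x0; have [xa|ax] := leP x a.
  by apply: le_trans xa _; rewrite lerDl mulr_ge0 ?powR_ge0.
have x_gt0 : 0 < x by exact: lt_trans ax.
rewrite -[leLHS]add0r; apply: lerD; first exact: ltW.
rewrite -[1 - p]opprB powRN mulrC ler_pdivlMr ?powR_gt0//.
rewrite -(mulr_powRB1 x0 (lt_le_trans ltr01 p1)) ler_pM2l//.
by apply: ge0_ler_powR; rewrite ?nnegrE ?subr_ge0// ltW.
Qed.

(* [hoelder] does not apply, as [w] and [f] are measurable only almost everywhere.  The factor [2]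
   is the price of the crude form [le_add_powR] of Young's inequality. *)
Lemma ge0_lower_integral_hoelder {d : measure_display} {T : measurableType d} {R : realType}
    (mu : {measure set T -> \bar R}) (D : set T) (p V P : R) (w f : T -> R) :
  1 < p -> measurable D -> 0 < V -> 0 < P ->
  (forall x, D x -> 0 < w x) -> ae_measurable mu D w ->
  (forall x, D x -> 0 <= f x) -> ae_measurable mu D f ->
  (\int[mu]_(x in D) (w x `^ (- (p - 1)^-1))%:E <= V%:E)%E ->
  (\int[mu]_(x in D) (w x * f x `^ p)%:E <= P%:E)%E ->
  (\int[mu]_(x in D) (f x)%:E <= (2 * (V `^ (1 - p^-1) * P `^ p^-1))%:E)%E.
Proof.
move=> p1 mD V0 P0 w0 mw f0 mf int_w int_f.
have p0 : 0 < p by exact: lt_trans p1.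
pose a := (P / V) `^ p^-1; have a0 : 0 < a by rewrite powR_gt0 ?divr_gt0.
have bound : 2 * (V `^ (1 - p^-1) * P `^ p^-1) = a * V + a `^ (1 - p) * P.
  rewrite /a -(lnK V0) -(lnK P0); move: (ln V) (ln P) => lV lP.
  rewrite -expRN -!expRD -!expRM -!expRD.
  have -> : (lP - lV) * p^-1 + lV = lV * (1 - p^-1) + lP * p^-1 by ring.
  have -> : (lP - lV) * p^-1 * (1 - p) + lP = lV * (1 - p^-1) + lP * p^-1.
    by field; rewrite gt_eqF.
  by rewrite mulr_natl mulr2n.
have w_gt0 x : D x -> 0 < a * w x `^ (- (p - 1)^-1).
  by move=> Dx; rewrite mulr_gt0// powR_gt0 ?w0.
have young x : D x -> f x <= a * w x `^ (- (p - 1)^-1) + a `^ (1 - p) * (w x * f x `^ p).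
  move=> Dx; apply: le_trans (le_add_powR (ltW p1) (w_gt0 x Dx) (f0 x Dx)) _.
  rewrite lerD2l powRM ?powR_ge0 ?(ltW a0)// -powRrM.
  have -> : - (p - 1)^-1 * (1 - p) = 1 by field; rewrite subr_eq0 gt_eqF.
  by rewrite powRr1 ?mulrA// ltW// w0.
have mw' : ae_measurable mu D (fun x => w x `^ (- (p - 1)^-1)).
  exact: (ae_measurable_comp (measurable_powR _) mw).
have mwf : ae_measurable mu D (fun x => w x * f x `^ p).
  by apply: ae_measurableM mw _; exact: (ae_measurable_comp (measurable_powR p) mf).
have wf0 x : D x -> 0 <= w x * f x `^ p by move=> Dx; rewrite mulr_ge0 ?powR_ge0// ltW// w0.
have cst_ae c : ae_measurable mu D (cst c : T -> R) by exact: measurable_ae_measurable.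
apply: (@le_trans _ _ (\int[mu]_(x in D)
    (a * w x `^ (- (p - 1)^-1) + a `^ (1 - p) * (w x * f x `^ p))%:E)%E).
  by apply: ge0_le_lower_integral => x Dx; rewrite lee_fin ?f0 ?young.
rewrite ge0_lower_integralD//; last 4 first.
- by move=> x Dx; rewrite ltW// w_gt0.
- exact: ae_measurableM (cst_ae a) mw'.
- by move=> x Dx; rewrite mulr_ge0 ?powR_ge0 ?wf0.
- exact: ae_measurableM (cst_ae (a `^ (1 - p))) mwf.
rewrite !ge0_lower_integralZl ?powR_ge0 ?(ltW a0)//; last by move=> x _; rewrite powR_ge0.
by rewrite bound EFinD !EFinM leeD// lee_wpmul2l// lee_fin ?powR_ge0// ltW.
Qed.

(** * Integrals of powers *)

Lemma ge0_integral_exhaustion_le {d : measure_display} {T : measurableType d} {R : realType}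
    (mu : {measure set T -> \bar R}) (F : nat -> set T) (D : set T) (f : T -> \bar R) (C : \bar R) :
  (forall n, measurable (F n)) -> nondecreasing_seq F -> D `<=` \bigcup_n F n ->
  measurable_fun setT f -> (forall x, 0 <= f x)%E ->
  (forall n, \int[mu]_(x in F n) f x <= C)%E -> (\int[mu]_(x in D) f x <= C)%E.
Proof.
move=> mF F_nd DF mf f0 int_F.
apply: le_trans (ge0_subset_lower_integral mu DF (fun x _ => f0 x)) _.
have F_cvg : (\int[mu]_(x in F n) f x)%E @[n --> \oo] --> (\int[mu]_(x in \bigcup_n F n) f x)%E.
  by apply: ge0_nondecreasing_set_cvg_integral => // n; exact: measurable_funTS.
by apply: (cvge_le _ F_cvg); exact: nearW.
Qed.

Section integral_powR.
Context {R : realType}.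
Implicit Types (al a b x : R).

Lemma powR_continuous al x : 0 < x -> {for x, continuous (fun s : R => s `^ al)}.
Proof.
move=> x0; apply: differentiable_continuous; apply/derivable1_diffP.
by have := is_derive1_powR al x0; case.
Qed.

Lemma is_derive1_powR_div al x : al != 0 -> 0 < x ->
  is_derive x 1 (fun s : R => s `^ al / al) (x `^ (al - 1)).
Proof.
move=> al0 x0; have := is_derive1_powR al x0 => ?.
rewrite (_ : (fun s : R => _) = al^-1 \*: (fun s : R => s `^ al)); last first.
  by apply/funext => s /=; rewrite mulrC.
by apply: is_derive_eq; rewrite /GRing.scale /= mulrA mulVf// mul1r.
Qed.

Lemma integral_powR al a b : al != 0 -> 0 < a -> a < b ->
  (\int[@leb R]_(s in `[a, b]) (s `^ (al - 1))%:E = ((b `^ al - a `^ al) / al)%:E)%E.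
Proof.
move=> al0 a0 ab; rewrite mulrBl EFinB.
have pos x : x \in `]a, b[ -> 0 < x by rewrite in_itv /= => /andP[ax _]; exact: lt_trans ax.
have b0 : 0 < b by exact: lt_trans ab.
have div_cvg x : 0 < x -> s `^ al / al @[s --> x] --> x `^ al / al.
  by move=> x0; apply: cvgM; [exact: powR_continuous|exact: cvg_cst].
apply: (@continuous_FTC2 _ (fun s => s `^ (al - 1)) (fun s => s `^ al / al)) => //.
- apply: continuous_in_subspaceT => x /set_mem /=; rewrite in_itv /= => /andP[ax _].
  by apply: powR_continuous; exact: lt_le_trans ax.
- split => [x /pos x0||].
  + by have [] := is_derive1_powR_div al0 x0.
  + by apply: cvg_at_right_filter; exact: div_cvg.
  + by apply: cvg_at_left_filter; exact: div_cvg.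
- by move=> x /pos x0; rewrite derive1E; have [_ ->] := is_derive1_powR_div al0 x0.
Qed.

Lemma measurable_powR_EFin al : measurable_fun setT (fun s : R => (s `^ al)%:E).
Proof. by apply/measurable_EFinP; exact: measurable_powR. Qed.

Lemma integral_powR_itvoo_le al a b : 0 < al -> 0 <= a -> a < b ->
  (\int[@leb R]_(s in `]a, b[) (s `^ (al - 1))%:E <= ((b `^ al - a `^ al) / al)%:E)%E.
Proof.
move=> al0 a0 ab; have ba0 : 0 < b - a by rewrite subr_gt0.
pose c n : R := a + (b - a) / n.+2%:R.
have c_gt n : a < c n by rewrite ltrDl divr_gt0.
apply: (ge0_integral_exhaustion_le (mu := @leb R) (F := fun n => `[c n, b]%classic)).
- by move=> n; exact: measurable_itv.
- move=> n m nm; apply/subsetPset => s /=; rewrite !in_itv /= => /andP[cs ->]; rewrite andbT.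
  by apply: le_trans cs; rewrite lerD2l ler_pM2l// lef_pV2 ?posrE// ler_nat !ltnS.
- move=> s /=; rewrite in_itv /= => /andP[as_ sb].
  exists (Num.truncn ((b - a) / (s - a))) => //=; rewrite in_itv /= (ltW sb) andbT.
  rewrite -lerBrDl ler_pdivrMr// mulrC -ler_pdivrMr ?subr_gt0//.
  by apply/ltW/(lt_trans (truncnS_gt _)); rewrite ltr_nat.
- exact: measurable_powR_EFin.
- by move=> s; rewrite lee_fin powR_ge0.
- move=> n; rewrite integral_powR ?gt_eqF// ?(le_lt_trans a0 (c_gt n))//; last first.
    by rewrite -ltrBrDl ltr_pdivrMr// ltr_pMr// ltr1n.
  rewrite lee_fin ler_pM2r ?invr_gt0// lerD2l lerN2.
  by apply: ge0_ler_powR; rewrite ?nnegrE ?(ltW al0)//; [apply: le_trans a0 _|]; exact/ltW.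
Qed.

Lemma integral_powRy_le al a : 0 < al -> 0 < a ->
  (\int[@leb R]_(s in `[a, +oo[) (s `^ (- al - 1))%:E <= (a `^ (- al) / al)%:E)%E.
Proof.
move=> al0 a0; pose F n : set R := `[a, a + n.+1%:R]%classic.
apply: (ge0_integral_exhaustion_le (mu := @leb R) (F := F)).
- by move=> n; exact: measurable_itv.
- move=> n m nm; apply/subsetPset => s; rewrite /F /= !in_itv /= => /andP[-> sn] /=.
  by apply: le_trans sn _; rewrite lerD2l ler_nat ltnS.
- move=> s /=; rewrite in_itv /= andbT => as_.
  exists (Num.truncn (s - a)) => //; rewrite /F /= in_itv /= as_ /=.
  by rewrite -lerBlDl; apply/ltW/truncnS_gt.
- exact: measurable_powR_EFin.
- by move=> s; rewrite lee_fin powR_ge0.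
- move=> n; rewrite integral_powR ?oppr_eq0 ?gt_eqF ?ltrDl//.
  by rewrite lee_fin invrN mulrN -mulNr opprB ler_pM2r ?invr_gt0// gerBl powR_ge0.
Qed.

Lemma powR_subr_le al t h : 0 < al <= 1 -> 0 < t -> 0 <= h <= t ->
  t `^ al - (t - h) `^ al <= h * t `^ (al - 1).
Proof.
move=> /andP[al0 al1] t0 /andP[h0]; rewrite le_eqVlt => /predU1P[->|ht].
  by rewrite subrr powR0 ?gt_eqF// subr0 mulr_powRB1// ltW.
have th0 : 0 < (t - h) / t by rewrite divr_gt0// subr_gt0.
rewrite -[in leLHS](divfK (lt0r_neq0 t0) (t - h)) powRM ?(ltW th0) ?(ltW t0)//.
rewrite -[X in X - _]mul1r -mulrBl -(mulr_powRB1 (ltW t0) al0) mulrA ler_wpM2r ?powR_ge0//.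
have : (t - h) / t <= ((t - h) / t) `^ al.
  by apply: ger1_powR; rewrite ?th0// ler_pdivrMr// mul1r gerBl.
have -> : (t - h) / t = 1 - h / t by field; rewrite gt_eqF.
by move=> ?; rewrite -ler_pdivlMr//; lra.
Qed.

End integral_powR.

(** * Mean values over windows *)

Lemma leb_itvoo {R : realType} (a b : R) : a <= b -> leb `]a, b[%classic = (b - a)%:E.
Proof.
rewrite /leb lebesgue_measure_itv /= lte_fin le_eqVlt => /predU1P[->|->]; last by rewrite EFinB.
by rewrite ltxx subrr.
Qed.

Lemma leb_itvoo_lty {R : realType} (a b : R) : (leb `]a, b[%classic < +oo)%E.
Proof. by rewrite /leb lebesgue_measure_itv /=; case: ifP => // _; rewrite -EFinB ltry. Qed.

Lemma exists_mean_le {R : realType} (a b P : R) (f : R -> R) (S : R -> Prop) :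
  a < b -> 0 < P -> (forall t, 0 <= f t) -> (\int[@leb R]_(t in `]a, b[) (f t)%:E <= P%:E)%E ->
  {ae @leb R, forall t, `]a, b[%classic t -> S t} ->
  exists t, [/\ a < t < b, S t & (b - a) * f t <= 2 * P].
Proof.
move=> ab P0 f0 int_f aeS; have ba0 : 0 < b - a by rewrite subr_gt0.
apply: contrapT => no_t; pose c := 2 * P / (b - a).
have c0 : 0 <= c by rewrite divr_ge0 ?mulr_ge0 ?ltW.
have f_ge : {ae @leb R, forall t, `]a, b[%classic t -> (c%:E <= (f t)%:E)%E}.
  apply: filterS aeS => t St tab; rewrite lee_fin ler_pdivrMr// leNgt; apply/negP => f_lt.
  apply: no_t; exists t; split; [by move: tab; rewrite /= in_itv|exact: St|].
  by rewrite mulrC ltW.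
have : (\int[@leb R]_(t in `]a, b[) c%:E <= P%:E)%E.
  by apply: le_trans int_f; apply: ge0_ae_le_lower_integral => // t _; rewrite lee_fin.
rewrite integral_cst ?measurable_itv// [X in (_ * X)%E](leb_itvoo (ltW ab)) -EFinM lee_fin.
by rewrite divfK ?gt_eqF//; lra.
Qed.

Section window.
Context {R : realType} {X : normedModType R}.
Variables p kappa : R.
Hypotheses (p_gt1 : 1 < p) (kappa_itv : 0 <= kappa < p - 1).
Implicit Types (t h P : R) (g : R -> X).

Definition window_const : R := 2 * (1 - kappa / (p - 1))^-1 `^ (1 - p^-1).

Definition window_bound t h P : R :=
  window_const * (h `^ (1 - p^-1) * (t `^ (- kappa) * P) `^ p^-1).

Let gamma_lt1 : 0 < 1 - kappa / (p - 1) <= 1.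
Proof.
have /andP[k0 kp] := kappa_itv; have p1 : 0 < p - 1 by rewrite subr_gt0.
by rewrite subr_gt0 ltr_pdivrMr// mul1r kp gerBl divr_ge0// ltW.
Qed.

Lemma window_const_gt0 : 0 < window_const.
Proof. by have /andP[gamma0 _] := gamma_lt1; rewrite mulr_gt0// powR_gt0// invr_gt0. Qed.

Lemma window_bound_gt0 t h P : 0 < t -> 0 < h -> 0 < P -> 0 < window_bound t h P.
Proof.
by move=> t0 h0 P0; rewrite /window_bound !(mulr_gt0 window_const_gt0, mulr_gt0, powR_gt0).
Qed.

Lemma integral_weight_window_le t h : 0 < h <= t ->
  (\int[@leb R]_(s in `](t - h)%R, t[) ((`|s| `^ kappa) `^ (- (p - 1)^-1))%:E <=
   (h * t `^ (- (kappa / (p - 1))) / (1 - kappa / (p - 1)))%:E)%E.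
Proof.
move=> /andP[h0 ht]; have [gamma0 gamma1] := andP gamma_lt1; set gamma := 1 - _ in gamma0 gamma1 *.
have t0 : 0 < t by exact: lt_le_trans ht.
have th0 : 0 <= t - h by rewrite subr_ge0.
have weightE s : `]t - h, t[%classic s -> (`|s| `^ kappa) `^ (- (p - 1)^-1) = s `^ (gamma - 1).
  rewrite /= in_itv /= => /andP[ths _].
  rewrite gtr0_norm ?(le_lt_trans th0)// -powRrM /gamma addrAC subrr add0r.
  by rewrite mulrN -mulNr.
under eq_integral => s /set_mem s_itv do rewrite (weightE s s_itv).
apply: le_trans (integral_powR_itvoo_le gamma0 th0 _) _; first by rewrite gtrBl.
rewrite lee_fin ler_pM2r ?invr_gt0//; apply: le_trans (powR_subr_le _ t0 _) _.
- by rewrite gamma0.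
- by rewrite ltW.
- by rewrite /gamma addrAC subrr add0r.
Qed.

Lemma integral_norm_window_le t h P g : 0 < h <= t -> 0 < P ->
  strongly_meas `]0, t[%classic g -> (wLp_int p kappa 0 t g <= P%:E)%E ->
  (\int[@leb R]_(s in `](t - h)%R, t[) (`|g s|)%:E <= (window_bound t h P)%:E)%E.
Proof.
move=> h_itv P0 sg gP; have [h0 ht] := andP h_itv; have [gamma0 _] := andP gamma_lt1.
have p0 : 0 < p by exact: lt_trans p_gt1.
have t0 : 0 < t by exact: lt_le_trans ht.
have th0 : 0 <= t - h by rewrite subr_ge0.
have window_sub : `]t - h, t[ `<=` `]0%R, t[.
  by move=> s /=; rewrite !in_itv /= => /andP[ths ->]; rewrite (le_lt_trans th0).
pose V := h * t `^ (- (kappa / (p - 1))) / (1 - kappa / (p - 1)).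
have V0 : 0 < V by rewrite divr_gt0// mulr_gt0// powR_gt0.
have -> : window_bound t h P = 2 * (V `^ (1 - p^-1) * P `^ p^-1).
  rewrite /V /window_bound /window_const -(lnK gamma0) -(lnK t0) -(lnK h0) -(lnK P0).
  move: (ln (1 - _)) (ln t) (ln h) (ln P) => lG lt lh lP.
  rewrite -!expRN -!expRM -!expRD -!expRM -!expRD -mulrA -!expRD; congr (2 * expR _).
  by field; rewrite gt_eqF//= subr_eq0 gt_eqF.
have mw : ae_measurable (@leb R) `](t - h)%R, t[%classic (fun s => `|s| `^ kappa).
  apply: measurable_ae_measurable; apply: (measurableT_comp (measurable_powR kappa)).
  exact: normr_measurable.
apply: (ge0_lower_integral_hoelder p_gt1 _ V0 P0 _ mw _ _ (integral_weight_window_le h_itv)).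
- exact: measurable_itv.
- move=> s /=; rewrite in_itv /= => /andP[ths _].
  by rewrite powR_gt0// normr_gt0 gt_eqF// (le_lt_trans th0).
- by [].
- by apply: ae_measurable_norm; exact: strongly_meas_subset sg.
- by apply: le_trans gP; exact: ge0_subset_lower_integral.
Qed.

Lemma wLp_L1 t g : 0 < t -> wLp p kappa 0 t g -> wLp 1 0 0 t g.
Proof.
move=> t0 wg; have [sg _] := wg; split; first exact: sg.
have t_itv : 0 < t <= t by rewrite t0 lexx.
pose P := fine (wLp_int p kappa 0 t g) + 1.
have P0 : 0 < P by rewrite ltr_wpDl// fine_ge0// wLp_int_ge0.
have gP : (wLp_int p kappa 0 t g <= P%:E)%E.
  by rewrite -(fineK (wLp_int_fin_num wg)) lee_fin lerDl.
have := integral_norm_window_le t_itv P0 sg gP; rewrite subrr => /le_lt_trans/(_ (ltry _)).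
by rewrite /wLp_int; under [X in _ -> (X < _)%E]eq_integral do rewrite powRr0 mul1r powRr1//.
Qed.

End window.

(** * Primitives of integrable functions *)

Section cumulative_integral.
Context {R : realType}.
Variable g : R -> R.
Hypotheses (g_ge0 : forall t, 0 <= g t) (g_int : (@leb R).-integrable setT (EFin \o g)).
Implicit Types (s t lam : R).

Definition cumul t : R := \int[@leb R]_(s in `]0, t[) g s.

Let measurable_g : measurable_fun setT g.
Proof. by apply/measurable_EFinP; have /integrableP[] := g_int. Qed.

Let integrable_g (D : set R) : measurable D -> (@leb R).-integrable D (EFin \o g).
Proof. by move=> mD; exact: integrableS g_int. Qed.

Lemma cumulE t : (\int[@leb R]_(s in `]0%R, t[) (g s)%:E = (cumul t)%:E)%E.
Proof. by rewrite fineK//; apply: integrable_fin_num => //; exact: integrable_g. Qed.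

Lemma cumul_ge0 t : 0 <= cumul t.
Proof. exact: Rintegral_ge0. Qed.

Lemma cumul_eq0 t : t <= 0 -> cumul t = 0.
Proof. by move=> t0; rewrite /cumul set_itv_ge ?Rintegral_set0// bnd_simp -leNgt. Qed.

Lemma cumul_le : {homo cumul : s t / s <= t}.
Proof.
move=> s t st; rewrite -lee_fin -!cumulE; apply: ge0_subset_lower_integral.
  exact: subset_itvoo_r.
by move=> r _; rewrite lee_fin.
Qed.

Lemma cumulB s t : 0 <= s -> s < t ->
  (\int[@leb R]_(r in `]s, t[) (g r)%:E = (cumul t - cumul s)%:E)%E.
Proof.
move=> s0 st.
have int_itv c : lebesgue_measure.-integrable [set` Interval (BRight 0) c] (EFin \o g).
  exact: integrable_g (measurable_itv _).
have -> : cumul t - cumul s = \int[@leb R]_(r in `]s, t[) g r.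
  rewrite /cumul /leb (Rintegral_itv_bndo_bndc (int_itv (BLeft s))).
  by rewrite (Rintegral_itvB (int_itv (BLeft t))) ?bnd_simp.
by rewrite /Rintegral fineK//; apply: integrable_fin_num => //; exact: integrable_g.
Qed.

Lemma cumul_continuous t : 0 <= t -> {within `[0, t], continuous cumul}.
Proof.
move=> t0; have -> : cumul = (parameterized_integral (@lebesgue_measure R) 0)^~ g.
  apply/funext => s; rewrite /cumul /parameterized_integral /Rintegral; congr fine.
  rewrite (@integral_itv_bndoo _ 0 s _ true false)//.
  by apply/measurable_EFinP; exact: measurable_funTS.
by apply: parameterized_integral_continuous => //; exact: integrable_g.
Qed.

Lemma measurable_expR_cumul lam :
  0 <= lam -> measurable_fun setT (fun t => g t * expR (lam * cumul t)).
Proof.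
move=> lam0; apply: measurable_funM => //; apply: (measurableT_comp (@measurable_expR R)).
apply: nondecreasing_measurable => // s t st; rewrite ler_wpM2l//.
exact: cumul_le.
Qed.

Lemma integral_expR_cumul_itv_le lam s t : 0 < lam -> 0 <= s -> s < t ->
  lam * (cumul t - cumul s) <= 1 ->
  (\int[@leb R]_(r in `]s, t[) (g r * expR (lam * cumul r))%:E <=
   (2 / lam * (expR (lam * cumul t) - expR (lam * cumul s)))%:E)%E.
Proof.
move=> lam0 s0 st; set z := cumul t - cumul s => z1.
have z0 : 0 <= lam * z by rewrite mulr_ge0 ?(ltW lam0)// subr_ge0 cumul_le// ltW.
apply: (@le_trans _ _ (expR (lam * cumul t) * z)%:E).
  rewrite EFinM -cumulB// -ge0_lower_integralZl ?expR_ge0//; last first.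
    exact: measurable_ae_measurable.
  apply: ge0_le_lower_integral => [r _|r]; rewrite lee_fin; first by rewrite mulr_ge0 ?expR_ge0.
  rewrite /= in_itv /= => /andP[_ rt].
  by rewrite mulrC ler_wpM2r// ler_expR ler_pM2l// cumul_le// ltW.
have -> : lam * cumul t = lam * cumul s + lam * z by rewrite /z; ring.
rewrite lee_fin expRD; set a := expR (lam * cumul s).
have -> : a * expR (lam * z) * z = lam^-1 * a * (lam * z * expR (lam * z)).
  by field; rewrite gt_eqF.
have -> : 2 / lam * (a * expR (lam * z) - a) = lam^-1 * a * (2 * (expR (lam * z) - 1)).
  by field; rewrite gt_eqF.
rewrite ler_wpM2l ?mulr_ge0 ?invr_ge0 ?expR_ge0 ?(ltW lam0)//.
by have := expR_ge1Dx (lam * z); nra.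
Qed.

(* The chain rule would give the factor [1 / lam]; summing over steps on which [lam * cumul]
   increases by at most one needs only the continuity of [cumul]. *)
Lemma integral_expR_cumul_le lam t : 0 < lam -> 0 <= t ->
  (\int[@leb R]_(r in `]0%R, t[) (g r * expR (lam * cumul r))%:E <=
   (2 / lam * (expR (lam * cumul t) - 1))%:E)%E.
Proof.
move=> lam0; have cumul0 : cumul 0 = 0 by exact: cumul_eq0.
have [n] : exists n, lam * cumul t <= n%:R.
  by exists (Num.truncn (lam * cumul t)).+1; exact/ltW/truncnS_gt.
elim: n t => [|n IH] t le_n; rewrite le_eqVlt => /predU1P[<-|t0].
- by rewrite set_itvoo0 integral_set0 cumul0 mulr0 expR0 subrr mulr0.
- have := integral_expR_cumul_itv_le lam0 (lexx 0) t0.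
  by rewrite cumul0 subr0 mulr0 expR0; apply; exact: le_trans le_n ler01.
- by rewrite set_itvoo0 integral_set0 cumul0 mulr0 expR0 subrr mulr0.
have [le_n'|n_lt] := leP (lam * cumul t) n%:R; first exact: IH le_n' (ltW t0).
have [s s_itv] : exists2 s, s \in `[0, t] & cumul s = n%:R / lam.
  apply: IVT; [exact: ltW|exact: cumul_continuous (ltW t0)|].
  rewrite cumul0 min_l ?cumul_ge0// max_r ?cumul_ge0// divr_ge0 ?(ltW lam0)//=.
  by rewrite ler_pdivrMr// mulrC ltW.
move=> /(congr1 ( *%R lam)); rewrite [RHS]mulrC divfK ?gt_eqF// => cumul_s.
move: s_itv; rewrite in_itv /= => /andP[s0]; rewrite le_eqVlt => /predU1P[s_t|st].
  by move: n_lt; rewrite -s_t cumul_s ltxx.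
rewrite (_ : `]0, t[%classic = `]0, s] `|` `]s, t[); last first.
  by rewrite -(@itv_bndbnd_setU _ _ (BRight 0) (BRight s)) ?bnd_simp.
have mw := measurable_expR_cumul (ltW lam0).
rewrite ge0_lower_integral_setU//; first last.
- exact: measurable_ae_measurable.
- by move=> r _; rewrite mulr_ge0 ?expR_ge0.
- apply/disj_setPS => r [] /=; rewrite !in_itv /= => /andP[_ rs] /andP[sr _].
  by move: (lt_le_trans sr rs); rewrite ltxx.
rewrite [X in (X + _)%E](_ : _ = \int[@leb R]_(r in `]0%R, s[) (g r * expR (lam * cumul r))%:E)%E;
  last first.
  apply/esym/integral_itv_bndo_bndc.
  by apply/measurable_EFinP; exact: measurable_funTS.
apply: le_trans (leeD (IH s _ s0) (integral_expR_cumul_itv_le lam0 s0 st _)) _.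
- by rewrite cumul_s.
- by rewrite mulrBr cumul_s lerBlDl natr1.
- by rewrite -EFinD -mulrDr addrC addrA subrK.
Qed.

End cumulative_integral.

(** * Initial values *)

Lemma exists_cumul_norm {R : realType} {X : normedModType R} (T : R) (h : R -> X) :
  strongly_meas `]0, T[%classic h -> (\int[@leb R]_(t in `]0%R, T[) (`|h t|)%:E < +oo)%E ->
  exists g : R -> R, [/\ forall t, 0 <= g t, (@leb R).-integrable setT (EFin \o g) &
    forall t, t <= T -> (\int[@leb R]_(s in `]0%R, t[) (`|h s|)%:E = (cumul g t)%:E)%E].
Proof.
move=> sh h_fin; have mI : measurable (`]0, T[%classic : set R) by exact: measurable_itv.
have [k [mk k0 _ int_h]] := ae_measurable_ge0 (fun _ _ => normr_ge0 _) (ae_measurable_norm sh).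
pose g := k \_ `]0, T[%classic; have g0 t : 0 <= g t by rewrite /g patchE; case: ifP.
have g_int : (@leb R).-integrable setT (EFin \o g).
  apply/integrableP; split.
    by apply/measurable_EFinP/measurable_restrict => //; exact: measurable_funTS.
  move: h_fin; rewrite (int_h _ (fun _ => id)) integral_mkcond.
  by congr (_ < _)%E; apply: eq_integral => t _; rewrite /= ger0_norm// /g !patchE; case: ifP.
exists g; split => // t tT; rewrite -cumulE// int_h; last exact: subset_itvoo_r.
by apply: eq_integral => s /set_mem /(subset_itvoo_r tT) sT; rewrite /g patchE mem_set.
Qed.

Lemma is_deriv0_init {R : realType} {X : normedModType R} (T : R) (h : R -> X) (c : X) :
  0 < T -> is_deriv 1 0 0 T (fun=> 0) h c -> c = 0.
Proof.
move=> T0 [[sh h_fin] hc].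
have {}h_fin : (\int[@leb R]_(t in `]0%R, T[) (`|h t|)%:E < +oo)%E.
  by move: h_fin; rewrite /wLp_int; under eq_integral do rewrite powRr0 mul1r powRr1//.
have [g [g0 g_int int_h]] := exists_cumul_norm sh h_fin.
have c_le : {ae @leb R, forall t, `]0, T[%classic t -> `|c| <= cumul g t}.
  apply: filterS hc => t hc tT; have := is_bochner_norm_le (measurable_itv _) (hc tT).
  move: tT; rewrite /= in_itv /= => /andP[_ /ltW tT].
  by rewrite sub0r normrN int_h// lee_fin.
apply/eqP; rewrite -normr_le0; apply/ler_addgt0Pr => e e0; rewrite add0r.
have [_ + _] := (continuous_within_itvP _ T0).1 (cumul_continuous g_int (ltW T0)).
rewrite cumul_eq0// => /cvgrPdist_lt /(_ e e0) [d /= d0 cumul_lt].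
have dT : 0 < Num.min d T by rewrite lt_min d0 T0.
have dT_T : Num.min d T <= T by rewrite ge_min lexx orbT.
have {}c_le : {ae @leb R, forall t, `]0, Num.min d T[%classic t -> `|c| <= cumul g t}.
  by apply: filterS c_le => t + /(subset_itvoo_r dT_T) tT => /(_ tT).
have int0 : (\int[@leb R]_(t in `]0%R, Num.min d T[) 0%:E <= 1%:E)%E by rewrite integral0 lee_fin.
have [t [t_itv c_le_t _]] := exists_mean_le dT ltr01 (fun=> lexx _) int0 c_le.
move: t_itv; rewrite lt_min => /and3P[t0 td _]; apply: le_trans c_le_t _.
have := cumul_lt t; rewrite /= !sub0r !normrN gtr0_norm// => /(_ td t0) /ltW.
exact: le_trans (ler_norm _).
Qed.

Lemma MR_is_deriv_init {R : realType} {X0 X1 : normedModType R} (J : X1 -> X0)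
    (Aop : R -> X1 -> X0) (p kappa T : R) (f : R -> X0) (u : R -> X1) (x : X0) :
  1 < p -> 0 <= kappa < p - 1 -> 0 < T ->
  MR J p kappa 0 T u -> strong_sol J Aop 0 T f x u ->
  exists g, is_deriv p kappa 0 T (J \o u) g x.
Proof.
move=> p1 kappaI T0 [_ [_ [g [c ug]]]] [_ [_ [_ [h [uh _]]]]]; exists g.
suff <- : c = x by [].
have ug1 : is_deriv 1 0 0 T (J \o u) g c by split; [exact: wLp_L1 ug.1|exact: ug.2].
have := is_derivB ler01 ug1 uh.
rewrite (_ : (fun t => (J \o u) t - _) = (fun=> 0)); last by apply/funext => t; rewrite subrr.
by move=> /(is_deriv0_init T0)/eqP; rewrite subr_eq0 => /eqP.
Qed.

(** * Real interpolation *)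

Lemma continuous_linear_norm_le {R : realType} {X Y : normedModType R} (J : {linear X -> Y}) :
  continuous J -> exists2 c, 0 < c & forall x, `|J x| <= c * `|x|.
Proof.
move=> cJ; have /linear_boundedP[M [_ norm_le_M]] := (linear_bounded_continuous J).2 cJ.
exists (`|M| + 1); first by rewrite ltr_pwDr.
by apply: norm_le_M; rewrite (le_lt_trans (ler_norm _))// ltrDl.
Qed.

Section interpolation.
Context {R : realType} {X0 X1 : normedModType R}.
Variable J : {linear X1 -> X0}.
Implicit Types (s t theta sigma m L lam : R) (x : X0) (y : X1).

Lemma Kfun_le t x y : 0 <= t -> Kfun J t (x + J y) <= `|x| + t * `|y|.
Proof.
move=> t0; apply: ge_inf; last by exists x, y.
by exists 0 => r [y0 [y1 [_ ->]]]; rewrite addr_ge0// mulr_ge0.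
Qed.

Lemma Kfun_le_norm t x : 0 <= t -> Kfun J t x <= `|x|.
Proof. by move=> /(Kfun_le x 0); rewrite linear0 addr0 normr0 mulr0 addr0. Qed.

Lemma Kfun_range_le t y : 0 <= t -> Kfun J t (J y) <= t * `|y|.
Proof. by move=> /(Kfun_le 0 y); rewrite !add0r normr0 add0r. Qed.

Lemma Kfun_ge0 t x : 0 <= t -> 0 <= Kfun J t x.
Proof.
move=> t0; apply: lb_le_inf.
  by exists (`|x| + t * `|0 : X1|), x, 0; rewrite linear0 addr0.
by move=> r [y0 [y1 [_ ->]]]; rewrite addr_ge0// mulr_ge0.
Qed.

Let interp_integrand_ge0 s theta x : 0 < s -> 0 <= s `^ (- theta) * Kfun J s x / s.
Proof. by move=> s0; rewrite divr_ge0 ?mulr_ge0 ?powR_ge0 ?Kfun_ge0// ltW. Qed.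

Lemma interp_int_ge0 theta x : (0 <= interp_int J theta x)%E.
Proof.
apply: integral_ge0 => s /=; rewrite in_itv /= andbT lee_fin.
exact: interp_integrand_ge0.
Qed.

Lemma interp_norm_ge0 theta x : 0 <= interp_norm J theta x.
Proof. exact/fine_ge0/interp_int_ge0. Qed.

Lemma integral_Kfun_le (D : set R) theta sigma L x : measurable D -> 0 <= L ->
  (forall s, D s -> 0 < s) -> (forall s, D s -> Kfun J s x <= L * s `^ sigma) ->
  (\int[@leb R]_(s in D) (s `^ (- theta) * Kfun J s x / s)%:E <=
   L%:E * \int[@leb R]_(s in D) (s `^ ((sigma - theta) - 1))%:E)%E.
Proof.
move=> mD L0 D0 K_le; rewrite -ge0_lower_integralZl//; last 2 first.
- by move=> s _; exact: powR_ge0.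
- by apply: measurable_ae_measurable; exact: measurable_powR.
apply: ge0_le_lower_integral => s Ds; rewrite lee_fin; first exact/interp_integrand_ge0/D0.
apply: (@le_trans _ _ (s `^ (- theta) * (L * s `^ sigma) / s)).
  by rewrite ler_pM2r ?invr_gt0 ?D0// ler_wpM2l ?powR_ge0// K_le.
rewrite -(lnK (D0 s Ds)) -!expRM -expRN mulrCA -mulrA -!expRD.
by rewrite (_ : _ + _ = ln s * (sigma - theta - 1))//; ring.
Qed.

Lemma interp_int_le theta sigma m L lam x : theta < 1 -> sigma < theta -> 0 < lam ->
  (forall s, 0 < s -> Kfun J s x <= s * m) -> (forall s, 0 < s -> Kfun J s x <= L * s `^ sigma) ->
  (interp_int J theta x <= (m * (lam `^ (1 - theta) / (1 - theta)) +
                            L * (lam `^ (sigma - theta) / (theta - sigma)))%:E)%E.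
Proof.
move=> theta1 sigma_theta lam0 Km KL.
have m0 : 0 <= m by have := le_trans (Kfun_ge0 x ler01) (Km 1 ltr01); rewrite mul1r.
have L0 : 0 <= L by have := le_trans (Kfun_ge0 x ler01) (KL 1 ltr01); rewrite powR1 mulr1.
rewrite /interp_int (_ : `]0%R, +oo[%classic = `]0, lam[ `|` `[lam, +oo[); last first.
  by rewrite -(@itv_bndbnd_setU _ _ (BRight 0) (BLeft lam))// ?bnd_simp.
apply: le_trans (ge0_lower_integralU_le _ _ _) _; first exact: measurable_itv.
  move=> s [] /=; rewrite in_itv /= ?andbT => s_itv; rewrite lee_fin interp_integrand_ge0//.
    by case/andP: s_itv.
  exact: lt_le_trans s_itv.
rewrite EFinD; apply: leeD.
  apply: le_trans (@integral_Kfun_le _ theta 1 m _ (measurable_itv _) m0 _ _) _.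
  - by move=> s /=; rewrite in_itv /= => /andP[].
  - by move=> s /=; rewrite in_itv /= => /andP[s0 _]; rewrite powRr1 ?(ltW s0)// mulrC Km.
  - rewrite EFinM lee_wpmul2l ?lee_fin//.
    have := @integral_powR_itvoo_le R (1 - theta) 0 lam; rewrite powR0 ?subr0; last first.
      by rewrite gt_eqF// subr_gt0.
    by apply; rewrite ?subr_gt0.
apply: le_trans (@integral_Kfun_le _ theta sigma L _ (measurable_itv _) L0 _ _) _.
- by move=> s /=; rewrite in_itv /= andbT; exact: lt_le_trans.
- by move=> s /=; rewrite in_itv /= andbT => lam_s; exact: KL (lt_le_trans lam0 lam_s).
- rewrite EFinM lee_wpmul2l ?lee_fin//.
  have theta_sigma : 0 < theta - sigma by rewrite subr_gt0.
  by have := integral_powRy_le theta_sigma lam0; rewrite opprB.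
Qed.

Lemma interp_norm_le theta sigma m L lam x : theta < 1 -> sigma < theta -> 0 < lam ->
  (forall s, 0 < s -> Kfun J s x <= s * m) -> (forall s, 0 < s -> Kfun J s x <= L * s `^ sigma) ->
  interp_norm J theta x <= m * (lam `^ (1 - theta) / (1 - theta)) +
                           L * (lam `^ (sigma - theta) / (theta - sigma)).
Proof.
move=> theta1 sigma_theta lam0 Km KL; have int_le := interp_int_le theta1 sigma_theta lam0 Km KL.
rewrite -lee_fin fineK// ge0_fin_numE ?interp_int_ge0//.
exact: le_lt_trans int_le (ltry _).
Qed.

Lemma interp_embedding theta : continuous J -> 0 < theta < 1 ->
  exists2 c, 0 < c & forall y, in_interp J theta (J y) /\ interp_norm J theta (J y) <= c * `|y|.
Proof.
move=> cJ /andP[theta0 theta1]; have [c c0 Jc] := continuous_linear_norm_le cJ.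
exists ((1 - theta)^-1 + c / theta).
  by rewrite addr_gt0 ?invr_gt0 ?subr_gt0// divr_gt0.
move=> y; have K_lin s : 0 < s -> Kfun J s (J y) <= s * `|y|.
  by move=> /ltW; exact: Kfun_range_le.
have K_cst s : 0 < s -> Kfun J s (J y) <= c * `|y| * s `^ 0.
  by move=> /ltW s0; rewrite powRr0 mulr1; apply: le_trans (Kfun_le_norm _ s0) (Jc y).
split.
  exact: le_lt_trans (interp_int_le theta1 theta0 ltr01 K_lin K_cst) (ltry _).
apply: le_trans (interp_norm_le theta1 theta0 ltr01 K_lin K_cst) _.
by rewrite !powR1 !mul1r subr0 le_eqVlt; apply/predU1P; left; ring.
Qed.

End interpolation.

(** * The trace estimate *)

Lemma is_bochner_itvB_norm_le {R : realType} {X : normedModType R} (a r t : R) (g : R -> X)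
    (v w : X) :
  a < r -> r < t -> is_bochner `]a, t[%classic g v -> is_bochner `]a, r[%classic g w ->
  ((`|v - w|)%:E <= \int[@leb R]_(s in `[r, t[) (`|g s|)%:E)%E.
Proof.
move=> ar rt gv gw; apply: is_bochner_norm_le; first exact: measurable_itv.
apply: is_bochner_setD gw; try exact: measurable_itv.
- apply/seteqP; split => s //= -[]; rewrite !in_itv /= => /andP[_ sr] /andP[rs _].
  by move: (lt_le_trans sr rs); rewrite ltxx.
- by rewrite -itv_bndbnd_setU// bnd_simp ltW.
Qed.

Section trace.
Context {R : realType} {X0 X1 : normedModType R}.
Variables (J : {linear X1 -> X0}) (p kappa T : R) (u : R -> X1) (g : R -> X0).
Hypotheses (p_gt1 : 1 < p) (kappa_itv : 0 <= kappa < p - 1).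
Hypotheses (su : strongly_meas `]0, T[%classic u) (ug : is_deriv p kappa 0 T (J \o u) g 0).
Implicit Types (t h P : R).

Let is_primitive t := is_bochner `]0, t[%classic g (J (u t)).

Let primitive_ae : {ae @leb R, forall t, `]0, T[%classic t -> is_primitive t}.
Proof. by apply: filterS ug.2 => t H /H; rewrite subr0. Qed.

(* Write [u t = (u t - u r) + u r] with [r] in [(t - h, t)] chosen such that [|u r|] is at most
   twice the mean of [|u|] over this window. *)
Let Kfun_window_le t h P : is_primitive t -> 0 < t <= T -> 0 < P -> 0 < h <= t ->
  (wLp_int p kappa 0 t u <= P%:E)%E -> (wLp_int p kappa 0 t g <= P%:E)%E ->
  Kfun J h (J (u t)) <= 3 * window_bound p kappa t h P.
Proof.
move=> ut /andP[t0 tT] P0 h_itv uP gP; have [h0 ht] := andP h_itv.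
have sut : strongly_meas `]0, t[%classic u.
  by apply: strongly_meas_subset su; exact: subset_itvoo_r.
have sgt : strongly_meas `]0, t[%classic g.
  by apply: strongly_meas_subset ug.1.1; exact: subset_itvoo_r.
have th0 : 0 <= t - h by rewrite subr_ge0.
have th : t - h < t by rewrite gtrBl.
have prim_ae : {ae @leb R, forall r, `](t - h)%R, t[%classic r -> is_primitive r}.
  apply: filterS primitive_ae => r prim; rewrite /= in_itv /= => /andP[hr rt]; apply: prim.
  by rewrite /= in_itv /= (le_lt_trans th0 hr) (lt_le_trans rt).
have bound_gt0 := window_bound_gt0 p_gt1 kappa_itv t0 h0 P0.
have [r [/andP[hr rt] ur]] := exists_mean_le th bound_gt0 (fun r => normr_ge0 (u r))
  (integral_norm_window_le p_gt1 kappa_itv h_itv P0 sut uP) prim_ae.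
rewrite subKr => u_le.
have g_le : `|J (u t) - J (u r)| <= window_bound p kappa t h P.
  rewrite -lee_fin; apply: le_trans (integral_norm_window_le p_gt1 kappa_itv h_itv P0 sgt gP).
  apply: le_trans (is_bochner_itvB_norm_le (le_lt_trans th0 hr) rt ut ur) _.
  apply: ge0_subset_lower_integral => [s /=|s _]; last by rewrite lee_fin.
  by rewrite !in_itv /= => /andP[rs ->]; rewrite (lt_le_trans hr rs).
rewrite -(subrK (J (u r)) (J (u t))); apply: le_trans (Kfun_le J _ _ (ltW h0)) _.
by apply: le_trans (lerD g_le u_le) _; lra.
Qed.

Lemma Kfun_trace_le :
  {ae @leb R, forall t, `]0, T[%classic t -> forall P, 0 < P ->
    (wLp_int p kappa 0 t u <= P%:E)%E -> (wLp_int p kappa 0 t g <= P%:E)%E ->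
    forall h, 0 < h -> Kfun J h (J (u t)) <= 3 * window_bound p kappa t h P}.
Proof.
apply: filterS primitive_ae => t ut /[dup] tI; rewrite /= in_itv /= => /andP[t0 /ltW tT].
move=> P P0 uP gP h h0.
have [ht|/ltW th] := leP h t.
  by apply: Kfun_window_le; rewrite ?t0 ?h0//; exact: ut.
have t_itv : 0 < t <= t by rewrite t0 lexx.
have sgt : strongly_meas `]0, t[%classic g.
  by apply: strongly_meas_subset ug.1.1; exact: subset_itvoo_r.
have norm_le : `|J (u t)| <= window_bound p kappa t t P.
  rewrite -lee_fin; have := integral_norm_window_le p_gt1 kappa_itv t_itv P0 sgt gP.
  by rewrite subrr; apply: le_trans; exact: is_bochner_norm_le (ut tI).
apply: le_trans (Kfun_le_norm J _ (ltW h0)) (le_trans norm_le _).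
apply: (@le_trans _ _ (window_bound p kappa t h P)); last first.
  by have := window_bound_gt0 p_gt1 kappa_itv t0 h0 P0; lra.
rewrite /window_bound ler_pM2l ?(window_const_gt0 p_gt1 kappa_itv)// ler_wpM2r ?powR_ge0//.
apply: ge0_ler_powR => //; rewrite ?nnegrE ?(ltW t0) ?(ltW h0)//.
by rewrite subr_ge0 invf_le1 ?(ltW p_gt1)// (lt_trans ltr01).
Qed.

End trace.

(** * The perturbation in terms of the solution *)

(* Optimization of the splitting point in [interp_norm_le]: the choice [lam = (delta / b) `^ q]
   makes the weight [b `^ q] appear with exponent one after raising to the power [p]. *)
Lemma mul_interp_norm_le {R : realType} {X0 X1 : normedModType R} (J : {linear X1 -> X0})
    (p q delta b m L : R) (x : X0) : 1 < p -> p < q -> 0 < delta -> 0 < b ->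
  (forall s, 0 < s -> Kfun J s x <= s * m) ->
  (forall s, 0 < s -> Kfun J s x <= L * s `^ (1 - p^-1)) ->
  b * interp_norm J (1 - q^-1) x <=
    q * delta * m + L / (p^-1 - q^-1) * (b `^ (q / p) * delta `^ (1 - q / p)).
Proof.
move=> p1 pq delta0 b0 Km KL.
have p0 : 0 < p by exact: lt_trans p1.
have q0 : 0 < q by exact: lt_trans pq.
have qp : q^-1 < p^-1 by rewrite ltf_pV2.
have q1 : 1 - q^-1 < 1 by rewrite gtrBl invr_gt0.
have pq1 : 1 - p^-1 < 1 - q^-1 by rewrite ltrD2l ltrN2.
have lam0 : 0 < (delta / b) `^ q by rewrite powR_gt0// divr_gt0.
apply: le_trans (ler_wpM2l (ltW b0) (interp_norm_le q1 pq1 lam0 Km KL)) _.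
rewrite !subKr -!powRrM -(lnK delta0) -(lnK b0).
move: (ln delta) (ln b) => ldelta lb.
rewrite -expRN -expRD -!expRM -expRD invrK.
have m_coef : expR lb * expR ((ldelta - lb) * (q / q)) = expR ldelta.
  by rewrite -expRD mulfV ?gt_eqF// mulr1 addrC subrK.
have L_coef : expR lb * expR ((ldelta - lb) * (q * (1 - p^-1 - (1 - q^-1)))) =
    expR (lb * (q / p) + ldelta * (1 - q / p)).
  by rewrite -expRD; congr expR; field; rewrite !gt_eqF.
rewrite -m_coef -L_coef (_ : 1 - q^-1 - (1 - p^-1) = p^-1 - q^-1); last by ring.
by rewrite le_eqVlt; apply/predU1P; left; ring.
Qed.

Section perturbation_bound.
Context {R : realType} {X0 X1 : normedModType R}.
Variables (J : {linear X1 -> X0}) (p q kappa : R).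
Hypotheses (p_gt1 : 1 < p) (p_lt_q : p < q) (kappa_itv : 0 <= kappa < p - 1).

Let p_gt0 : 0 < p. Proof. exact: lt_trans p_gt1. Qed.
Let q_gt0 : 0 < q. Proof. exact: lt_trans p_lt_q. Qed.

Definition perturb_const (delta : R) : R :=
  (2 * (3 * window_const p kappa / (p^-1 - q^-1))) `^ p * delta `^ (p - q).

Lemma perturb_const_ge0 delta : 0 <= perturb_const delta.
Proof. by rewrite mulr_ge0 ?powR_ge0. Qed.

Definition perturb_rate (delta lam : R) : R :=
  (2 * (q * delta)) `^ p + perturb_const delta * (2 / lam).

Lemma perturb_pointwise_le (delta t b P : R) (x : X1) (y : X0) : 0 < delta -> 0 < t -> 0 < P ->
  (forall h, 0 < h -> Kfun J h (J x) <= 3 * window_bound p kappa t h P) ->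
  `|y| <= b * interp_norm J (1 - q^-1) (J x) ->
  t `^ kappa * `|y| `^ p <=
    (2 * (q * delta)) `^ p * (t `^ kappa * `|x| `^ p) + perturb_const delta * (`|b| `^ q * P).
Proof.
move=> delta0 t0 P0 Kx yb; have [b0|b0] := leP b 0.
  have -> : `|y| = 0.
    apply/le_anti; rewrite normr_ge0 andbT; apply: le_trans yb _.
    by rewrite mulr_le0_ge0// interp_norm_ge0.
  by rewrite powR0 ?gt_eqF// mulr0 addr_ge0// !mulr_ge0 ?powR_ge0 ?(ltW P0) ?perturb_const_ge0.
pose Q := t `^ (- kappa) * P; pose L := 3 * window_const p kappa * Q `^ p^-1.
pose k := 3 * window_const p kappa / (p^-1 - q^-1).
have K_lin s : 0 < s -> Kfun J s (J x) <= s * `|x| by move=> /ltW; exact: Kfun_range_le.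
have K_trace s : 0 < s -> Kfun J s (J x) <= L * s `^ (1 - p^-1).
  by move=> /Kx; rewrite /window_bound /L -/Q mulrA mulrA mulrAC.
have y_le : `|y| <= q * delta * `|x| + k * (b `^ (q / p) * delta `^ (1 - q / p) * Q `^ p^-1).
  apply: le_trans yb (le_trans (mul_interp_norm_le p_gt1 p_lt_q delta0 b0 K_lin K_trace) _).
  by rewrite /k /L le_eqVlt; apply/predU1P; left; ring.
pose c := b `^ (q / p) * delta `^ (1 - q / p) * Q `^ p^-1.
have Q0 : 0 < Q by rewrite mulr_gt0 ?powR_gt0.
have k0 : 0 <= k.
  apply: divr_ge0; first by rewrite mulr_ge0// ltW// window_const_gt0.
  by rewrite subr_ge0 lef_pV2 ?posrE// ltW.
have c0 : 0 <= c by rewrite !mulr_ge0 ?powR_ge0.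
have qdelta0 : 0 <= q * delta by rewrite mulr_ge0// ltW.
have qx0 : 0 <= q * delta * `|x| by exact: mulr_ge0.
have kc0 : 0 <= k * c by exact: mulr_ge0.
have cE : c `^ p = b `^ q * delta `^ (p - q) * Q.
  rewrite /c -(lnK b0) -(lnK delta0) -(lnK Q0); move: (ln b) (ln delta) (ln Q) => lb ldelta lQ.
  by rewrite -!expRM -!expRD -expRM; congr expR; field; rewrite gt_eqF.
have y_powR_le : `|y| `^ p <= 2 `^ p * ((q * delta * `|x|) `^ p + (k * c) `^ p).
  have := @powR_normD_le R R^o p (q * delta * `|x|) (k * c) (ltW p_gt0).
  rewrite (ger0_norm qx0) (ger0_norm kc0) (ger0_norm (addr_ge0 qx0 kc0)); apply: le_trans.
  by apply: ge0_ler_powR; rewrite ?nnegrE ?(ltW p_gt0) ?(addr_ge0 qx0 kc0).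
have PE : P = t `^ kappa * Q by rewrite /Q powRN mulrA mulfV ?mul1r// gt_eqF// powR_gt0.
apply: le_trans (ler_wpM2l (powR_ge0 _ _) y_powR_le) _.
rewrite /perturb_const -/k (gtr0_norm b0) (powRM _ qdelta0 (normr_ge0 x)) (powRM _ k0 c0).
rewrite (powRM _ (ler0n R 2) qdelta0) (powRM _ (ler0n R 2) k0) cE PE.
by rewrite le_eqVlt; apply/predU1P; left; ring.
Qed.

End perturbation_bound.

(** * Bielecki norms *)

Lemma lee_add_geometric {R : realType} (x : \bar R) (a c z : R) : `|z| < 1 ->
  (forall n, x <= (a + c * z ^+ n)%:E)%E -> (x <= a%:E)%E.
Proof.
move=> z1 x_le.
have lim_a : (a + c * z ^+ n)%:E @[n --> \oo] --> a%:E.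
  apply: cvg_EFin; first exact: nearW.
  rewrite -[X in _ --> X]addr0; apply: cvgD; first exact: cvg_cst.
  exact: cvg_geometric.
by apply: (cvge_ge _ lim_a); exact: nearW.
Qed.

(* [D] bounds the [p]-th power of an exponentially weighted norm, for which a Volterra operator is
   a contraction if [lam] is large. *)
Definition bielecki_le {R : realType} {X : normedModType R} (p kappa lam : R) (beta : R -> R)
    (T : R) (f : R -> X) (D : R) : Prop :=
  forall t, 0 < t <= T -> (wLp_int p kappa 0 t f <= (D * expR (lam * beta t))%:E)%E.

(* For the [p]-th power of the norm the triangle inequality holds with the factor [2 `^ p], which
   iterations with this ratio absorb. *)
Definition contraction_ratio {R : realType} (p : R) : R := 2 `^ (- p) / 2.

Lemma contraction_ratio_gt0 {R : realType} (p : R) : 0 < contraction_ratio p.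
Proof. by rewrite divr_gt0// powR_gt0. Qed.

Section bielecki.
Context {R : realType} {X : normedModType R}.
Variables (p kappa lam : R) (beta : R -> R) (T : R).
Hypotheses (p_gt0 : 0 < p) (lam_ge0 : 0 <= lam) (beta_ge0 : forall t, 0 <= beta t).
Implicit Types (f g F G : R -> X) (a D : R).

Local Notation bielecki_le := (bielecki_le p kappa lam beta T).

Lemma expR_beta_ge1 t : 1 <= expR (lam * beta t).
Proof. by rewrite -expR0 ler_expR mulr_ge0. Qed.

Lemma bielecki_of_wLp_int f D : 0 <= D -> (wLp_int p kappa 0 T f <= D%:E)%E -> bielecki_le f D.
Proof.
move=> D0 fD t /andP[_ tT]; apply: le_trans (wLp_int_subitv_le _ _ _ _ tT) (le_trans fD _).
by rewrite lee_fin ler_peMr// expR_beta_ge1.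
Qed.

Lemma bielecki_wLp f : wLp p kappa 0 T f -> exists2 D, 0 < D & bielecki_le f D.
Proof.
move=> wf; exists (fine (wLp_int p kappa 0 T f) + 1).
  by rewrite ltr_wpDl// fine_ge0// wLp_int_ge0.
apply: bielecki_of_wLp_int; first by rewrite addr_ge0// fine_ge0// wLp_int_ge0.
by rewrite -[leLHS](fineK (wLp_int_fin_num wf)) lee_fin lerDl.
Qed.

Lemma ae_eq_bielecki f g D : {ae @leb R, forall t, `]0, T[%classic t -> f t = g t} ->
  bielecki_le f D -> bielecki_le g D.
Proof.
move=> fg fD t tT; rewrite -(@ae_eq_wLp_int _ _ p kappa 0 t f g); first exact: fD.
have [_ t_le] := andP tT.
by apply: filterS fg => s fg st; apply: fg; exact: subset_itvoo_r st.
Qed.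

Lemma bielecki_leW f D E : D <= E -> bielecki_le f D -> bielecki_le f E.
Proof.
move=> DE fD t tT; apply: le_trans (fD t tT) _.
by rewrite lee_fin ler_wpM2r ?expR_ge0.
Qed.

Lemma bieleckiN f D : bielecki_le f D -> bielecki_le (fun t => - f t) D.
Proof. by move=> fD t tT; rewrite wLp_intN; exact: fD. Qed.

Lemma bieleckiD f g D E : strongly_meas `]0, T[%classic f -> strongly_meas `]0, T[%classic g ->
  bielecki_le f D -> bielecki_le g E -> bielecki_le (fun t => f t + g t) (2 `^ p * (D + E)).
Proof.
move=> sf sg fD gE t /[dup] tT /andP[_ t_le].
have sub (h : R -> X) : strongly_meas `]0, T[%classic h -> strongly_meas `]0, t[%classic h.
  by apply: strongly_meas_subset; exact: subset_itvoo_r.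
apply: le_trans (wLp_intD_le _ (ltW p_gt0) (sub f sf) (sub g sg)) _.
rewrite -mulrA mulrDl EFinM EFinD.
by rewrite lee_wpmul2l ?lee_fin ?powR_ge0// leeD ?fD ?gE.
Qed.

(* Starting from an arbitrary bound for [F], every use of [F = f - G] halves its excess over the
   claimed one. *)
Lemma bielecki_absorb f F G a : 0 <= a -> wLp p kappa 0 T F -> wLp p kappa 0 T f ->
  wLp p kappa 0 T G -> (forall t, F t = f t - G t) ->
  (forall D, 0 < D -> bielecki_le F D -> bielecki_le G (contraction_ratio p * D)) ->
  bielecki_le f a -> bielecki_le F (2 * 2 `^ p * a).
Proof.
move=> a0 wF wf wG FE contr fa; have [D D0 FD] := bielecki_wLp wF.
have two_p0 : 0 < 2 `^ p :> R by rewrite powR_gt0.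
have FDn n : bielecki_le F (2 * 2 `^ p * a + D * 2^-1 ^+ n).
  elim: n => [|n IH] t tT.
    apply: le_trans (FD t tT) _; rewrite lee_fin expr0 mulr1 ler_wpM2r ?expR_ge0//.
    by rewrite lerDr !mulr_ge0 ?(ltW two_p0).
  have Dn0 : 0 < 2 * 2 `^ p * a + D * 2^-1 ^+ n.
    by rewrite ltr_wpDl ?mulr_ge0 ?mulr_gt0 ?exprn_gt0 ?(ltW two_p0).
  rewrite (eq_wLp_int _ _ _ _ FE).
  apply: le_trans (bieleckiD wf.1 (wLpN wG).1 fa (bieleckiN (contr _ Dn0 IH)) tT) _.
  rewrite lee_fin ler_wpM2r ?expR_ge0// /contraction_ratio powRN exprS.
  by rewrite le_eqVlt; apply/predU1P; left; field; rewrite gt_eqF.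
move=> t tT; apply: (@lee_add_geometric R _ _ (D * expR (lam * beta t)) 2^-1).
  by rewrite ger0_norm ?invr_ge0// invf_lt1// ltr1n.
by move=> n; apply: le_trans (FDn n t tT) _; rewrite lee_fin mulrDl [D * _ * _]mulrAC.
Qed.

End bielecki.

(** * Completeness and fixed points *)

Section completeness.
Context {R : realType} {X : completeNormedModType R}.
Implicit Types x : nat -> X.

Lemma cvg_geometric_increments x (M : R) : (forall n, `|x n.+1 - x n| <= M / 2 ^+ n.+1) ->
  exists l, x @ \oo --> l /\ forall n, `|l - x n| <= M / 2 ^+ n.
Proof.
move=> x_incr.
have M0 : 0 <= M by have := le_trans (normr_ge0 _) (x_incr 0%N); rewrite pmulr_lge0// invr_gt0.
have tail n k : `|x (n + k)%N - x n| <= M / 2 ^+ n - M / 2 ^+ (n + k).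
  elim: k => [|k IH]; first by rewrite addn0 !subrr normr0.
  rewrite addnS -[X in `|X|](subrKA (x (n + k)%N)); apply: le_trans (ler_normD _ _) _.
  apply: le_trans (lerD (x_incr _) IH) _; rewrite exprS.
  have -> : M / 2 ^+ (n + k) = 2 * (M / (2 * 2 ^+ (n + k))) by field; rewrite expf_neq0.
  lra.
have {}tail n k : `|x (n + k)%N - x n| <= M / 2 ^+ n.
  by apply: le_trans (tail n k) _; rewrite gerBl divr_ge0// exprn_ge0.
have /cvg_ex[l xl] : cvgn x.
  have : cvgn (series (telescope x)).
    apply: normed_cvg; apply: (@series_le_cvg _ _ (geometric (M / 2) 2^-1)) => [n|n|n|] /=.
    - exact: normr_ge0.
    - by rewrite mulr_ge0 ?divr_ge0// exprn_ge0// invr_ge0.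
    - apply: le_trans (x_incr n) _; rewrite exprS exprVn le_eqVlt; apply/predU1P; left.
      by field; rewrite expf_neq0.
    - by apply: is_cvg_geometric_series; rewrite ger0_norm ?invr_ge0// invf_lt1// ltr1n.
  rewrite telescopeK => /cvg_ex[l xl]; apply/cvg_ex; exists (l + x 0%N).
  have -> : x = (fun n => (x n - x 0%N) + x 0%N) by apply/funext => n; rewrite subrK.
  by rewrite subrr add0r; apply: cvgD => //; exact: cvg_cst.
exists l; split => // n.
have dist_cvg : (fun k => `|x (k + n)%N - x n|) @ \oo --> `|l - x n|.
  by apply: cvg_norm; apply: cvgB; [rewrite cvg_shiftn|exact: cvg_cst].
rewrite -(cvg_lim (@Rhausdorff R) dist_cvg); apply: limr_le; first exact: cvgP dist_cvg.
by apply: nearW => k; rewrite addnC.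
Qed.

Lemma cvg_powR_increments x (p w G : R) : 0 < p -> 0 < w ->
  (forall n, (2 `^ p) ^+ n.+1 * (w * `|x n.+1 - x n| `^ p) <= G) ->
  exists l, x @ \oo --> l /\ forall n, w * `|l - x n| `^ p <= (2 `^ (- p)) ^+ n * G.
Proof.
move=> p0 w0 x_incr; have powR_exp n : (2 ^+ n) `^ p = (2 `^ p) ^+ n :> R.
  by rewrite -!powR_mulrn ?powR_ge0// -!powRrM mulrC.
have G0 : 0 <= G.
  by apply: le_trans (x_incr 0%N); rewrite mulr_ge0 ?exprn_ge0 ?mulr_ge0 ?powR_ge0// ltW.
pose M := (G / w) `^ p^-1.
have Mp : M `^ p = G / w by rewrite -powRrM mulVf ?gt_eqF// powRr1// divr_ge0// ltW.
have incr_le n : `|x n.+1 - x n| <= M / 2 ^+ n.+1.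
  rewrite ler_pdivlMr ?exprn_gt0// -[leLHS](powR_invK _ p0) ?mulr_ge0 ?exprn_ge0//.
  apply: ge0_ler_powR; rewrite ?nnegrE ?invr_ge0 ?powR_ge0 ?divr_ge0 ?(ltW p0) ?(ltW w0)//.
  rewrite ler_pdivlMr// powRM ?exprn_ge0// powR_exp.
  by rewrite (_ : _ * w = (2 `^ p) ^+ n.+1 * (w * `|x n.+1 - x n| `^ p)); [exact: x_incr|ring].
have [l [xl l_le]] := cvg_geometric_increments incr_le; exists l; split => // n.
apply: (@le_trans _ _ (w * (M / 2 ^+ n) `^ p)).
  rewrite ler_pM2l//; apply: ge0_ler_powR; rewrite ?nnegrE ?(ltW p0)//.
  by rewrite divr_ge0 ?powR_ge0// exprn_ge0.
rewrite powRM ?powR_ge0 ?invr_ge0 ?exprn_ge0// Mp.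
have -> : (2 ^- n) `^ p = (2 `^ (- p)) ^+ n :> R.
  by rewrite -powR_inv1 ?exprn_ge0// powRAC powR_exp powRN exprVn powR_inv1// exprn_ge0 ?powR_ge0.
by rewrite (mulrC G) mulrA mulrA mulfV ?gt_eqF// mul1r mulrC.
Qed.

Section wLp_completeness.
Variables (p kappa a b C : R) (f : nat -> R -> X).
Hypotheses (p_gt0 : 0 < p) (C_ge0 : 0 <= C) (wLp_f : forall n, wLp p kappa a b (f n)).
Hypothesis f_increments : forall n,
  (wLp_int p kappa a b (fun t => f n.+1 t - f n t)%R <= (C * contraction_ratio p ^+ n)%:E)%E.

Let mI : measurable (`]a, b[%classic : set R). Proof. exact: measurable_itv. Qed.

(* The integrals of the increments remain summable after multiplication by [2 `^ (p (n + 1))]. *)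
Let increments_majorant : exists G : R -> R, [/\ forall t, 0 <= G t, measurable_fun setT G,
  (\int[@leb R]_(t in `]a, b[) (G t)%:E <= (2 * 2 `^ p * C)%:E)%E &
  {ae @leb R, forall t, `]a, b[%classic t -> forall n,
    (2 `^ p) ^+ n.+1 * (`|t| `^ kappa * `|f n.+1 t - f n t| `^ p) <= G t}].
Proof.
have two_p0 : 0 < 2 `^ p :> R by rewrite powR_gt0.
have mf n : ae_measurable (@leb R) `]a, b[%classic
    (fun t => `|t| `^ kappa * `|f n.+1 t - f n t| `^ p).
  exact: ae_measurable_wLp (strongly_measB (wLp_f n.+1).1 (wLp_f n).1).
apply: (ae_summable_majorant (mu := @leb R) mI) => [|n t _|n|n].
- by rewrite !mulr_ge0// ltW.
- by rewrite mulr_ge0 ?exprn_ge0 ?wLp_integrand_ge0.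
- by apply: ae_measurableM (mf n); exact: measurable_ae_measurable.
rewrite ge0_lower_integralZl ?exprn_ge0//.
apply: le_trans (lee_wpmul2l _ (f_increments n)) _; first by rewrite lee_fin exprn_ge0.
rewrite -EFinM lee_fin /contraction_ratio powRN natrX exprMn !exprVn !exprS.
by rewrite le_eqVlt; apply/predU1P; left; field; rewrite !expf_neq0// gt_eqF.
Qed.

Lemma wLp_complete : exists2 F, wLp p kappa a b F & forall n,
  (wLp_int p kappa a b (fun t => F t - f n t)%R <= (2 * 2 `^ p * C * (2 `^ (- p)) ^+ n)%:E)%E.
Proof.
have [G [G0 mG int_G fG]] := increments_majorant; pose F t := limn (f^~ t).
have F_spec : {ae @leb R, forall t, `]a, b[%classic t -> f n t @[n --> \oo] --> F t /\
    forall n, `|t| `^ kappa * `|F t - f n t| `^ p <= (2 `^ (- p)) ^+ n * G t}.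
  apply: filterS2 (ae_neq 0) fG => t t0 fG tI.
  have w0 : 0 < `|t| `^ kappa by rewrite powR_gt0// normr_gt0.
  have [l [fl l_le]] := cvg_powR_increments p_gt0 w0 (fG tI).
  by rewrite /F (cvg_lim (@norm_hausdorff _ _) fl).
have sF : strongly_meas `]a, b[%classic F.
  apply: (strongly_meas_cvg mI (leb_itvoo_lty a b) (fun n => (wLp_f n).1)).
  by apply: filterS F_spec => t H /H[].
have F_le n : (wLp_int p kappa a b (fun t => F t - f n t)%R <=
    (2 * 2 `^ p * C * (2 `^ (- p)) ^+ n)%:E)%E.
  rewrite mulrC EFinM; apply: le_trans (lee_wpmul2l _ int_G); last first.
    by rewrite lee_fin exprn_ge0 ?powR_ge0.
  rewrite -ge0_lower_integralZl ?exprn_ge0 ?powR_ge0//; last exact: measurable_ae_measurable.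
  apply: ge0_ae_le_lower_integral => [t _|t _|].
  - by rewrite lee_fin (wLp_integrand_ge0 _ _ (fun t => F t - f n t)).
  - by rewrite lee_fin mulr_ge0 ?exprn_ge0 ?powR_ge0.
  - by apply: filterS F_spec => t H /H[_ /(_ n)]; rewrite lee_fin.
exists F => //; have wF0 : wLp p kappa a b (fun t => F t - f 0%N t).
  by split; [exact: strongly_measB sF (wLp_f 0%N).1|exact: le_lt_trans (F_le 0%N) (ltry _)].
have := wLpD (ltW p_gt0) wF0 (wLp_f 0%N).
by rewrite (_ : (fun t => _ + _) = F)//; apply/funext => t; rewrite subrK.
Qed.

End wLp_completeness.

End completeness.

Section bielecki_fixpoint.
Context {R : realType} {X : completeNormedModType R}.
Variables (p kappa lam : R) (beta : R -> R) (T : R) (L : (R -> X) -> R -> X).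
Hypotheses (p_gt0 : 0 < p) (lam_ge0 : 0 <= lam) (beta_ge0 : forall t, 0 <= beta t) (T_gt0 : 0 < T).
Implicit Types (F G : R -> X) (D : R).

Local Notation bielecki_le := (bielecki_le p kappa lam beta T).

Hypothesis wLp_L : forall F, wLp p kappa 0 T F -> wLp p kappa 0 T (L F).
Hypothesis L_contracts : forall F G D, wLp p kappa 0 T F -> wLp p kappa 0 T G -> 0 < D ->
  bielecki_le (fun t => F t - G t) D ->
  bielecki_le (fun t => L F t - L G t) (contraction_ratio p * D).

Local Notation rho := (contraction_ratio p).
Let T_itv : 0 < T <= T. Proof. by rewrite T_gt0 lexx. Qed.

Let picard n : R -> X := iter n L (fun=> 0).

Let wLp_picard n : wLp p kappa 0 T (picard n).
Proof. by elim: n => [|n IH]; [exact: wLp0|exact: wLp_L]. Qed.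

Let picard_increments : exists2 C, 0 <= C & forall n,
  (wLp_int p kappa 0 T (fun t => picard n.+1 t - picard n t)%R <= (C * rho ^+ n)%:E)%E.
Proof.
have [D D0 FD] := bielecki_wLp lam_ge0 beta_ge0 (wLpB (ltW p_gt0) (wLp_picard 1) (wLp_picard 0)).
exists (D * expR (lam * beta T)) => [|n]; first by rewrite mulr_ge0 ?expR_ge0// ltW.
suff : bielecki_le (fun t => picard n.+1 t - picard n t) (rho ^+ n * D).
  by move=> /(_ T T_itv); rewrite -mulrA [rho ^+ n * _]mulrC.
elim: n => [|n IH]; first by rewrite expr0 mul1r.
rewrite exprS -mulrA; apply: (L_contracts (wLp_picard n.+1) (wLp_picard n) _ IH).
by rewrite mulr_gt0// exprn_gt0// contraction_ratio_gt0.
Qed.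

Lemma bielecki_fixpoint :
  exists2 F, wLp p kappa 0 T F & {ae @leb R, forall t, `]0, T[%classic t -> F t = L F t}.
Proof.
have [C C0 incr] := picard_increments.
have [F wF F_le] := wLp_complete p_gt0 C0 wLp_picard incr; exists F => //.
pose z : R := 2 `^ (- p).
have z0 : 0 < z by rewrite powR_gt0.
have z1 : z < 1.
  have : 1 `^ p < 2 `^ p :> R by apply: gt0_ltr_powR; rewrite ?nnegrE// ltr1n.
  by rewrite /z powRN invf_lt1 ?powR_gt0// powR1.
pose K := 2 * 2 `^ p * C + 1; have K0 : 0 < K by rewrite ltr_wpDl// !mulr_ge0 ?powR_ge0.
have F_picard n : bielecki_le (fun t => F t - picard n t) (K * z ^+ n).
  apply: bielecki_of_wLp_int => //; first by rewrite mulr_ge0 ?exprn_ge0 ?ltW.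
  by apply: le_trans (F_le n) _; rewrite lee_fin ler_wpM2r ?exprn_ge0 ?powR_ge0// lerDl.
have residual_le n : (wLp_int p kappa 0 T (fun t => F t - L F t)%R <=
    (0 + 2 `^ p * K * (z + rho) * expR (lam * beta T) * z ^+ n)%:E)%E.
  have LF_picard : bielecki_le (fun t => - (L F t - picard n.+1 t)) (rho * (K * z ^+ n)).
    apply: bieleckiN; apply: (L_contracts wF (wLp_picard n) _ (F_picard n)).
    by rewrite mulr_gt0// exprn_gt0.
  have sF_picard := (wLpB (ltW p_gt0) wF (wLp_picard n.+1)).1.
  have sLF_picard := (wLpN (wLpB (ltW p_gt0) (wLp_L wF) (wLp_picard n.+1))).1.
  have := bieleckiD p_gt0 sF_picard sLF_picard (F_picard n.+1) LF_picard T_itv.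
  rewrite (eq_wLp_int _ _ _ _ (g := fun t => F t - L F t)); last first.
    by move=> t; rewrite opprB subrKA.
  by move=> /le_trans; apply; rewrite lee_fin exprS le_eqVlt; apply/predU1P; left; ring.
have residual0 : wLp_int p kappa 0 T (fun t => F t - L F t) = 0%E.
  by apply/le_anti; rewrite wLp_int_ge0 andbT (lee_add_geometric _ residual_le)// gtr0_norm.
have := wLp_int_eq0 p_gt0 (wLpB (ltW p_gt0) wF (wLp_L wF)).1 residual0.
by apply: filterS => t + tI => /(_ tI)/eqP; rewrite subr_eq0 => /eqP.
Qed.

End bielecki_fixpoint.

(** * The perturbed problem *)

Section Lq_density.
Context {R : realType}.
Variables (q T : R) (b : R -> R).

Definition Lq_density : R -> R := (fun t => `|b t| `^ q) \_ `]0, T[.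

Lemma Lq_density_ge0 t : 0 <= Lq_density t.
Proof. by rewrite /Lq_density patchE; case: ifP => // _; exact: powR_ge0. Qed.

Lemma Lq_densityE t : 0 < t < T -> Lq_density t = `|b t| `^ q.
Proof. by move=> tT; rewrite /Lq_density patchE mem_set//= in_itv. Qed.

Lemma integral_Lq_density :
  (\int[@leb R]_t (Lq_density t)%:E = \int[@leb R]_(t in `]0%R, T[) (`|b t| `^ q)%:E)%E.
Proof.
rewrite [RHS]integral_mkcond; apply: eq_integral => t _.
by rewrite /Lq_density !patchE; case: ifP.
Qed.

Lemma integrable_Lq_density : measurable_fun `]0, T[%classic b -> Lq_fin q 0 T b ->
  (@leb R).-integrable setT (EFin \o Lq_density).
Proof.
move=> mb b_fin; have mI : measurable (`]0, T[%classic : set R) by exact: measurable_itv.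
apply/integrableP; split.
  apply/measurable_EFinP/measurable_restrict => //; rewrite setTI.
  apply: (measurableT_comp (measurable_powR q)).
  exact: (measurableT_comp (@normr_measurable R setT)).
under eq_integral do rewrite gee0_abs ?lee_fin ?Lq_density_ge0//.
by rewrite integral_Lq_density.
Qed.

Lemma cumul_Lq_density_le t : 0 < q -> measurable_fun `]0, T[%classic b -> Lq_fin q 0 T b ->
  cumul Lq_density t <= Lq_norm q 0 T b `^ q.
Proof.
move=> q0 mb b_fin; rewrite /Lq_norm -integral_Lq_density -powRrM mulVf ?gt_eqF//.
rewrite powRr1; last first.
  by apply/fine_ge0/integral_ge0 => s _; rewrite lee_fin Lq_density_ge0.
have g_int := integrable_Lq_density mb b_fin.
rewrite -lee_fin -(cumulE g_int) fineK; last exact: integrable_fin_num.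
by apply: ge0_subset_lower_integral => // s _; rewrite lee_fin Lq_density_ge0.
Qed.

End Lq_density.

(* [E t] stands for [B t \o J]. *)
Record interp_perturbation {R : realType} {X0 X1 : normedModType R} (J : {linear X1 -> X0})
    (q T : R) (E : R -> X1 -> X0) (b : R -> R) : Prop := InterpPerturbation {
  perturb_linear : forall t, linear (E t);
  perturb_meas : forall x, strongly_meas `[0, T]%classic (fun t => E t x);
  perturb_norm_le : forall t, 0 <= t <= T -> forall x,
    `|E t x| <= b t * interp_norm J (1 - q^-1) (J x);
  perturb_measurable_bound : measurable_fun `]0, T[%classic b;
  perturb_Lq_bound : Lq_fin q 0 T b }.

Section interp_perturbation.
Context {R : realType} {X0 X1 : normedModType R}.
Variables (J : {linear X1 -> X0}) (p q kappa T tau : R) (E : R -> X1 -> X0) (b : R -> R).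
Hypotheses (J_cont : continuous J) (p_gt1 : 1 < p) (p_lt_q : p < q).
Hypotheses (kappa_itv : 0 <= kappa < p - 1) (tau_itv : 0 < tau <= T).
Hypothesis EP : interp_perturbation J q T E b.
Implicit Types (delta lam D : R) (u v : R -> X1) (g F : R -> X0).

Local Notation beta := (cumul (Lq_density q T b)).

Let p_gt0 : 0 < p. Proof. exact: lt_trans p_gt1. Qed.
Let q_gt0 : 0 < q. Proof. exact: lt_trans p_lt_q. Qed.
Let density_ge0 : forall t, 0 <= Lq_density q T b t. Proof. exact: Lq_density_ge0. Qed.
Let density_int : (@leb R).-integrable setT (EFin \o Lq_density q T b).
Proof. exact: integrable_Lq_density (perturb_measurable_bound EP) (perturb_Lq_bound EP). Qed.
Let beta_ge0 t : 0 <= beta t. Proof. exact: cumul_ge0. Qed.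

Let subset_itv0T (t : R) : `]0, tau[%classic t -> 0 <= t <= T.
Proof.
have [_ tauT] := andP tau_itv; rewrite /= in_itv /= => /andP[t0 t_tau].
by rewrite ltW//= (le_trans (ltW t_tau)).
Qed.

Lemma perturb_sub t : zmod_morphism (E t).
Proof. exact: zmod_morphism_linear (perturb_linear EP t). Qed.

Lemma strongly_meas_perturb_step (s : step X1) : step_meas s ->
  strongly_meas `]0, tau[%classic (fun t => E t (step_fun s t)).
Proof.
case: s => n A x ms; elim: n ms => [|n IH] ms.
  rewrite (_ : (fun t => _) = (fun=> 0)); first exact: strongly_meas0.
  by apply/funext => t; rewrite /step_fun big_ord0 -{1}(subrr 0) perturb_sub subrr.
rewrite (_ : (fun t => _) = (fun t =>
    \1_(A n) t *: E t (x n) + E t (step_fun (Step n A x) t))); last first.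
  by apply/funext => t; rewrite step_fun_recr addrC (perturb_linear EP).
apply: strongly_measD; last by apply: IH => i; exact: ms.
apply: strongly_meas_indic; first exact: ms.
apply: strongly_meas_subset (perturb_meas EP (x n)) => t [/subset_itv0T tT _].
by rewrite /= in_itv.
Qed.

Lemma strongly_meas_perturb u : strongly_meas `]0, tau[%classic u ->
  strongly_meas `]0, tau[%classic (fun t => E t (u t)).
Proof.
move=> [s [ms su]]; have theta : 0 < 1 - q^-1 < 1.
  by rewrite subr_gt0 invf_lt1// (lt_trans p_gt1 p_lt_q) gtrBl invr_gt0.
have [c c0 norm_le] := interp_embedding J_cont theta.
apply: (strongly_meas_cvg (measurable_itv _) (leb_itvoo_lty 0 tau)
  (fun n => strongly_meas_perturb_step (ms n))).
apply: filterS su => t su /[dup] t_tau /subset_itv0T tT.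
have dist_le n : `|E t (step_fun (s n) t) - E t (u t)| <=
    `|b t| * c * `|step_fun (s n) t - u t|.
  rewrite -perturb_sub; apply: le_trans (perturb_norm_le EP tT _) _.
  apply: le_trans (ler_wpM2r (interp_norm_ge0 _ _ _) (ler_norm (b t))) _.
  by rewrite -mulrA ler_wpM2l//; exact: (norm_le _).2.
apply/subr_cvg0/norm_cvg0P; apply: (@squeeze_cvgr _ _ _ _ (fun=> 0)
    (fun n => `|b t| * c * `|step_fun (s n) t - u t|)).
- by apply: nearW => n; rewrite normr_ge0 dist_le.
- exact: cvg_cst.
- rewrite -[X in _ --> X](mulr0 (`|b t| * c)); apply: cvgM; first exact: cvg_cst.
  by apply/norm_cvg0P/subr_cvg0; exact: su.
Qed.

Lemma perturb_integrand_le delta lam D u g : 0 < delta -> 0 < D ->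
  strongly_meas `]0, tau[%classic u -> is_deriv p kappa 0 tau (J \o u) g 0 ->
  bielecki_le p kappa lam beta tau u D -> bielecki_le p kappa lam beta tau g D ->
  {ae @leb R, forall t, `]0, tau[%classic t -> `|t| `^ kappa * `|E t (u t)| `^ p <=
    (2 * (q * delta)) `^ p * (`|t| `^ kappa * `|u t| `^ p) +
    perturb_const p q kappa delta * D * (Lq_density q T b t * expR (lam * beta t))}.
Proof.
move=> delta0 D0 su ug uD gD; have [_ tauT] := andP tau_itv.
apply: filterS (Kfun_trace_le p_gt1 kappa_itv su ug) => t Kt /[dup] t_tau /Kt {}Kt.
have tT := subset_itv0T t_tau; move: t_tau; rewrite /= in_itv /= => /andP[t0 t_tau].
have P0 : 0 < D * expR (lam * beta t) by rewrite mulr_gt0 ?expR_gt0.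
have t_itv : 0 < t <= tau by rewrite t0 ltW.
have := perturb_pointwise_le p_gt1 p_lt_q kappa_itv delta0 t0 P0
  (Kt _ P0 (uD t t_itv) (gD t t_itv)) (perturb_norm_le EP tT (u t)).
rewrite (gtr0_norm t0) Lq_densityE ?t0 ?(lt_le_trans t_tau)// => /le_trans; apply.
by rewrite le_eqVlt; apply/predU1P; left; ring.
Qed.

Lemma perturb_wLp_int_le delta lam D u g : 0 < delta -> 0 < lam -> 0 < D ->
  strongly_meas `]0, tau[%classic u -> is_deriv p kappa 0 tau (J \o u) g 0 ->
  bielecki_le p kappa lam beta tau u D -> bielecki_le p kappa lam beta tau g D ->
  (wLp_int p kappa 0 tau (fun t => E t (u t)) <=
    (perturb_rate p q kappa delta lam * D * expR (lam * beta tau))%:E)%E.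
Proof.
move=> delta0 lam0 D0 su ug uD gD; have [tau0 _] := andP tau_itv.
have mI : measurable (`]0, tau[%classic : set R) by exact: measurable_itv.
have C0 : 0 <= perturb_const p q kappa delta * D.
  by rewrite mulr_ge0 ?perturb_const_ge0// ltW.
have w0 t : 0 <= Lq_density q T b t * expR (lam * beta t) by rewrite mulr_ge0 ?expR_ge0.
have u0 t : 0 <= `|t| `^ kappa * `|u t| `^ p by exact: wLp_integrand_ge0.
have meas_w : ae_measurable (@leb R) `]0, tau[%classic
    (fun t => Lq_density q T b t * expR (lam * beta t)).
  by apply: measurable_ae_measurable; apply: measurable_expR_cumul => //; exact: ltW.
have meas_u : ae_measurable (@leb R) `]0, tau[%classic (fun t => `|t| `^ kappa * `|u t| `^ p).
  exact: ae_measurable_wLp.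
have cst_ae (c : R) : ae_measurable (@leb R) `]0, tau[%classic (cst c).
  exact: measurable_ae_measurable.
apply: (@le_trans _ _ (\int[@leb R]_(t in `]0%R, tau[)
    ((2 * (q * delta)) `^ p * (`|t| `^ kappa * `|u t| `^ p) +
     perturb_const p q kappa delta * D * (Lq_density q T b t * expR (lam * beta t)))%:E)%E).
  apply: ge0_ae_le_lower_integral => [t _|t _|].
  - by rewrite lee_fin (wLp_integrand_ge0 _ _ (fun t => E t (u t))).
  - by rewrite lee_fin addr_ge0// mulr_ge0// powR_ge0.
  - by apply: filterS (perturb_integrand_le delta0 D0 su ug uD gD) => t + tI => /(_ tI).
rewrite ge0_lower_integralD//; last 4 first.
- by move=> t _; rewrite mulr_ge0 ?powR_ge0.
- exact: ae_measurableM (cst_ae _) meas_u.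
- by move=> t _; rewrite mulr_ge0.
- exact: ae_measurableM (cst_ae _) meas_w.
rewrite !ge0_lower_integralZl ?powR_ge0//.
have -> : perturb_rate p q kappa delta lam * D * expR (lam * beta tau) =
    (2 * (q * delta)) `^ p * (D * expR (lam * beta tau)) +
    perturb_const p q kappa delta * D * (2 / lam * expR (lam * beta tau)).
  by rewrite /perturb_rate; ring.
rewrite EFinD; apply: leeD.
  rewrite EFinM lee_wpmul2l ?lee_fin ?powR_ge0//; apply: uD.
  by rewrite tau0 lexx.
have exp_le := integral_expR_cumul_le density_ge0 density_int lam0 (ltW tau0).
apply: le_trans (lee_wpmul2l _ exp_le) _; first by rewrite lee_fin.
by rewrite -EFinM lee_fin !ler_wpM2l ?gerBl ?divr_ge0// ltW.
Qed.

Lemma wLp_perturb (Aop : R -> X1 -> X0) F v :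
  MR J p kappa 0 tau v -> strong_sol J Aop 0 tau F 0 v ->
  wLp p kappa 0 tau (fun t => E t (v t)).
Proof.
move=> Mv Sv; have [tau0 _] := andP tau_itv.
have [g vg] := MR_is_deriv_init p_gt1 kappa_itv tau0 Mv Sv.
split; first exact: strongly_meas_perturb Mv.1.1.
have [D D0 vD] := bielecki_wLp ler01 beta_ge0 Mv.1.
have [D' D'0 gD'] := bielecki_wLp ler01 beta_ge0 vg.1.
have DD0 : 0 < D + D' by rewrite addr_gt0.
have vDD : bielecki_le p kappa 1 beta tau v (D + D').
  by apply: bielecki_leW vD; rewrite lerDl ltW.
have gDD : bielecki_le p kappa 1 beta tau g (D + D').
  by apply: bielecki_leW gD'; rewrite lerDr ltW.
exact: le_lt_trans (perturb_wLp_int_le ltr01 ltr01 DD0 Mv.1.1 vg vDD gDD) (ltry _).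
Qed.

End interp_perturbation.

Lemma exists_perturb_rate_le {R : realType} (p q kappa K rho : R) :
  0 < p -> 0 < q -> 0 < K -> 0 < rho ->
  exists delta lam, [/\ 0 < delta, 0 < lam & perturb_rate p q kappa delta lam * K <= rho].
Proof.
move=> p0 q0 K0 rho0; have rhoK0 : 0 < rho / (2 * K) by rewrite divr_gt0 ?mulr_gt0.
pose delta := (rho / (2 * K)) `^ p^-1 / (2 * q).
have delta0 : 0 < delta by rewrite divr_gt0 ?mulr_gt0 ?powR_gt0.
have C0 := perturb_const_ge0 p q kappa delta; set C := perturb_const _ _ _ _ in C0.
pose lam := 4 * (C * K) / rho + 1.
have CK0 : 0 <= 4 * (C * K) := mulr_ge0 (ler0n R 4) (mulr_ge0 C0 (ltW K0)).
have lam0 : 0 < lam by rewrite ltr_wpDl// divr_ge0 ?(ltW rho0).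
exists delta, lam; split => //; rewrite /perturb_rate -/C.
have -> : (2 * (q * delta)) `^ p = rho / (2 * K).
  have -> : 2 * (q * delta) = (rho / (2 * K)) `^ p^-1.
    by rewrite /delta; field; rewrite gt_eqF.
  by rewrite -powRrM mulVf ?gt_eqF// powRr1// ltW.
rewrite mulrDl [leRHS](splitr rho); apply: lerD.
  by rewrite le_eqVlt; apply/predU1P; left; field; rewrite gt_eqF.
have -> : C * (2 / lam) * K = 2 * (C * K) / lam by ring.
rewrite ler_pdivrMr// /lam mulrDr mulr1.
rewrite (_ : rho / 2 * (4 * (C * K) / rho) = 2 * (C * K)); last by field; rewrite gt_eqF.
by rewrite lerDl divr_ge0 ?(ltW rho0).
Qed.

Lemma MR_est_bielecki_le {R : realType} {X0 X1 : normedModType R} (J : X1 -> X0)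
    (p kappa lam T K D : R) (beta : R -> R) (Aop : R -> X1 -> X0) (F g : R -> X0) (v : R -> X1)
    (x : X0) :
  0 < p -> 0 <= K -> MR_est J p kappa Aop 0 T K ->
  wLp p kappa 0 T F -> MR J p kappa 0 T v -> strong_sol J Aop 0 T F 0 v ->
  is_deriv p kappa 0 T (J \o v) g x -> bielecki_le p kappa lam beta T F D ->
  bielecki_le p kappa lam beta T v (K `^ p * D) /\ bielecki_le p kappa lam beta T g (K `^ p * D).
Proof.
move=> p0 K0 estK wF Mv Sv vg FD.
have bound t (t_itv : 0 < t <= T) :
    (wLp_int p kappa 0 t v <= (K `^ p * D * expR (lam * beta t))%:E)%E /\
    (wLp_int p kappa 0 t g <= (K `^ p * D * expR (lam * beta t))%:E)%E.
  have [_ tT] := andP t_itv; have vg' := is_deriv_subitv tT vg.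
  have v_le := estK F wF t t_itv v (MR_subitv tT Mv) (strong_sol_subitv tT Sv) g x vg'.
  have [int_v int_g] := MR_norm_wLp_int_le p0 K0 (wLp_subitv tT Mv.1) vg'.1 (wLp_subitv tT wF) v_le.
  have F_le : ((K `^ p)%:E * wLp_int p kappa 0 t F <= (K `^ p * D * expR (lam * beta t))%:E)%E.
    by rewrite -mulrA EFinM lee_wpmul2l ?lee_fin ?powR_ge0// FD.
  exact: (conj (le_trans int_v F_le) (le_trans int_g F_le)).
by split=> t /bound[].
Qed.

Section perturbed_problem.
Context {R : realType} {X0 X1 : normedModType R}.
Variables (J : {linear X1 -> X0}) (p q kappa T : R) (E Aop : R -> X1 -> X0) (b : R -> R).
Variables (K delta lam : R).
Hypotheses (J_cont : continuous J) (p_gt1 : 1 < p) (p_lt_q : p < q).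
Hypotheses (kappa_itv : 0 <= kappa < p - 1) (EP : interp_perturbation J q T E b).
Hypotheses (K_gt0 : 0 < K) (delta_gt0 : 0 < delta) (lam_gt0 : 0 < lam).
Hypothesis rate_le : perturb_rate p q kappa delta lam * K `^ p <= contraction_ratio p.
Implicit Types (v : R -> X1) (f g F : R -> X0) (tau D : R).

Local Notation beta := (cumul (Lq_density q T b)).
Local Notation perturbed := (fun t x => Aop t x + E t x).

Let p_gt0 : 0 < p. Proof. exact: lt_trans p_gt1. Qed.
Let beta_ge0 t : 0 <= beta t. Proof. by apply: cumul_ge0 => s; exact: Lq_density_ge0. Qed.

Lemma perturb_contracts tau F v D : 0 < tau <= T -> MR_est J p kappa Aop 0 tau K ->
  wLp p kappa 0 tau F -> MR J p kappa 0 tau v -> strong_sol J Aop 0 tau F 0 v -> 0 < D ->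
  bielecki_le p kappa lam beta tau F D ->
  bielecki_le p kappa lam beta tau (fun t => E t (v t)) (contraction_ratio p * D).
Proof.
move=> tau_itv estK wF Mv Sv D0 FD; have [tau0 tauT] := andP tau_itv.
have [g vg] := MR_is_deriv_init p_gt1 kappa_itv tau0 Mv Sv.
have [vD gD] := MR_est_bielecki_le p_gt0 (ltW K_gt0) estK wF Mv Sv vg FD.
have KD0 : 0 < K `^ p * D by rewrite mulr_gt0 ?powR_gt0.
move=> t /andP[t0 t_tau]; have tT : 0 < t <= T by rewrite t0 (le_trans t_tau).
have sub (X : normedModType R) (h : R -> X) C :
    bielecki_le p kappa lam beta tau h C -> bielecki_le p kappa lam beta t h C.
  by move=> hC s /andP[s0 st]; apply: hC; rewrite s0 (le_trans st).
apply: le_trans (perturb_wLp_int_le p_gt1 p_lt_q kappa_itv tT EP delta_gt0 lam_gt0 KD0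
  (wLp_subitv t_tau Mv.1).1 (is_deriv_subitv t_tau vg) (sub _ _ _ vD) (sub _ _ _ gD)) _.
by rewrite lee_fin ler_wpM2r ?expR_ge0// mulrA ler_wpM2r// ltW.
Qed.

Lemma perturbed_MR_norm_le tau f v : 0 < tau <= T -> MR_est J p kappa Aop 0 tau K ->
  wLp p kappa 0 tau f -> MR J p kappa 0 tau v -> strong_sol J perturbed 0 tau f 0 v ->
  MR_norm_le J p kappa 0 tau v
    (K * (2 * 2 `^ p * expR (lam * beta tau)) `^ p^-1 * wLp_norm p kappa 0 tau f).
Proof.
move=> tau_itv estK wf Mv Sv g c vg; have [tau0 tauT] := andP tau_itv.
have wE := wLp_perturb J_cont p_gt1 p_lt_q kappa_itv tau_itv EP Mv Sv.
pose F t := f t - E t (v t).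
have wF : wLp p kappa 0 tau F := wLpB (ltW p_gt0) wf wE.
have SF : strong_sol J Aop 0 tau F 0 v.
  exact/(strong_solDl _ _ _ _ (wLp_L1 p_gt1 kappa_itv tau0 wE)).
pose a := fine (wLp_int p kappa 0 tau f).
have a0 : 0 <= a by exact/fine_ge0/wLp_int_ge0.
have fa : bielecki_le p kappa lam beta tau f a.
  by apply: bielecki_of_wLp_int => //; [exact: ltW|rewrite fineK// wLp_int_fin_num].
have contracts D : 0 < D -> bielecki_le p kappa lam beta tau F D ->
    bielecki_le p kappa lam beta tau (fun t => E t (v t)) (contraction_ratio p * D).
  exact: perturb_contracts.
have F_le := bielecki_absorb p_gt0 (ltW lam_gt0) beta_ge0 a0 wF wf wE (fun=> erefl) contracts fa.
have C0 : 0 <= 2 * 2 `^ p * expR (lam * beta tau) by rewrite !mulr_ge0 ?powR_ge0 ?expR_ge0.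
have norm_F : wLp_norm p kappa 0 tau F <=
    (2 * 2 `^ p * expR (lam * beta tau)) `^ p^-1 * wLp_norm p kappa 0 tau f.
  rewrite (wLp_norm_leE p_gt0 (powR_ge0 _ _) wF wf) -powRrM mulVf ?gt_eqF// powRr1//.
  have tau_tau : 0 < tau <= tau by rewrite tau0 lexx.
  apply: le_trans (F_le tau tau_tau) _.
  by rewrite -[X in (_ <= _ * X)%E](fineK (wLp_int_fin_num wf)) -EFinM lee_fin mulrAC.
apply: le_trans (estK F wF tau _ v Mv SF g c vg) _; first by rewrite tau0 lexx.
by rewrite -mulrA ler_wpM2l// ltW.
Qed.

Lemma perturbed_MR_est : MR_est J p kappa Aop 0 T K ->
  MR_est J p kappa perturbed 0 T
    (K * (2 * 2 `^ p * expR (lam * Lq_norm q 0 T b `^ q)) `^ p^-1).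
Proof.
move=> estK f wf tau tau_itv v Mv Sv g c vg; have [tau0 tauT] := andP tau_itv.
have estK_tau := MR_est_subitv p_gt0 tauT estK.
have q_gt0 : 0 < q by exact: lt_trans p_lt_q.
apply: le_trans (perturbed_MR_norm_le tau_itv estK_tau (wLp_subitv tauT wf) Mv Sv vg) _.
rewrite ler_wpM2r ?powR_ge0// ler_wpM2l ?(ltW K_gt0)//.
apply: ge0_ler_powR; rewrite ?nnegrE ?invr_ge0 ?(ltW p_gt0) ?mulr_ge0 ?powR_ge0 ?expR_ge0//.
rewrite ler_wpM2l ?mulr_ge0 ?powR_ge0// ler_expR ler_pM2l//.
exact: cumul_Lq_density_le (perturb_measurable_bound EP) (perturb_Lq_bound EP).
Qed.

End perturbed_problem.

Section perturbed_existence.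
Context {R : realType} {X0 : completeNormedModType R} {X1 : normedModType R}.
Variables (J : {linear X1 -> X0}) (p q kappa T : R) (E Aop : R -> X1 -> X0) (b : R -> R).
Variables (K delta lam : R).
Hypotheses (J_cont : continuous J) (p_gt1 : 1 < p) (p_lt_q : p < q).
Hypotheses (kappa_itv : 0 <= kappa < p - 1) (T_gt0 : 0 < T).
Hypotheses (EP : interp_perturbation J q T E b) (Aop_sub : forall t, zmod_morphism (Aop t)).
Hypotheses (K_gt0 : 0 < K) (delta_gt0 : 0 < delta) (lam_gt0 : 0 < lam).
Hypothesis rate_le : perturb_rate p q kappa delta lam * K `^ p <= contraction_ratio p.
Hypothesis estK : MR_est J p kappa Aop 0 T K.
Hypothesis solvable : forall f, wLp p kappa 0 T f ->
  exists u, MR J p kappa 0 T u /\ strong_sol J Aop 0 T f 0 u.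
Implicit Types f F G : R -> X0.

Let p_gt0 : 0 < p. Proof. exact: lt_trans p_gt1. Qed.
Let T_itv : 0 < T <= T. Proof. by rewrite T_gt0 lexx. Qed.

Let solution_operator : exists S : (R -> X0) -> R -> X1, forall F, wLp p kappa 0 T F ->
  MR J p kappa 0 T (S F) /\ strong_sol J Aop 0 T F 0 (S F).
Proof.
suff /choice[S S_spec] : forall F, exists u, wLp p kappa 0 T F ->
    MR J p kappa 0 T u /\ strong_sol J Aop 0 T F 0 u by exists S.
move=> F; have [/solvable[u u_spec]|nF] := pselect (wLp p kappa 0 T F); first by exists u.
by exists (fun=> 0) => /nF.
Qed.

(* Picard iteration acts on the right-hand side [F = f - E (S F)], where [S] is the solution
   operator of [Aop]: no limit of solutions has to be identified. *)
Lemma perturbed_solution f : wLp p kappa 0 T f ->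
  exists u, MR J p kappa 0 T u /\ strong_sol J (fun t x => Aop t x + E t x) 0 T f 0 u.
Proof.
move=> wf; have [S S_spec] := solution_operator.
have wES F : wLp p kappa 0 T F -> wLp p kappa 0 T (fun t => E t (S F t)).
  move=> wF; have [MF SF] := S_spec F wF.
  exact: (wLp_perturb J_cont p_gt1 p_lt_q kappa_itv T_itv EP MF SF).
pose L F t := f t - E t (S F t).
have wL F : wLp p kappa 0 T F -> wLp p kappa 0 T (L F).
  by move=> wF; exact: wLpB (ltW p_gt0) wf (wES F wF).
pose beta := cumul (Lq_density q T b).
have beta0 t : 0 <= beta t by apply: cumul_ge0 => s; exact: Lq_density_ge0.
have L_contracts F G D : wLp p kappa 0 T F -> wLp p kappa 0 T G -> 0 < D ->
    bielecki_le p kappa lam beta T (fun t => F t - G t) D ->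
    bielecki_le p kappa lam beta T (fun t => L F t - L G t) (contraction_ratio p * D).
  move=> wF wG D0 FGD; have [MF SF] := S_spec F wF; have [MG SG] := S_spec G wG.
  have := strong_solB Aop_sub SF SG; rewrite subr0 => SFG.
  have := perturb_contracts p_gt1 p_lt_q kappa_itv EP K_gt0 delta_gt0 lam_gt0 rate_le T_itv estK
    (wLpB (ltW p_gt0) wF wG) (MRB p_gt0 MF MG) SFG D0 FGD.
  move=> /bieleckiN; apply: ae_eq_bielecki; apply: aeW => t _.
  by rewrite (perturb_sub EP) /L [in RHS]opprD opprK addrACA subrr add0r opprB addrC.
have [F wF FL] := bielecki_fixpoint p_gt0 (ltW lam_gt0) beta0 T_gt0 wL L_contracts.
have [MF SF] := S_spec F wF; exists (S F); split; first exact: MF.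
apply/(strong_solDl _ _ _ _ (wLp_L1 p_gt1 kappa_itv T_gt0 (wES F wF))).
exact: ae_eq_strong_sol FL SF.
Qed.

End perturbed_existence.

Theorem theorem2p5 (R : realType) (X0 X1 : completeNormedModType R)
  (J : {linear X1 -> X0})
  (J_inj : injective J) (J_cont : continuous J)
  (J_dense : closure (range J) = setT)
  (p q kappa : R) (hp : 1 < p) (hkappa : 0 <= kappa < p - 1) (hq : p < q)
  (M N : R) :
  exists C : R,
  forall (T : R) (A : R -> {linear X1 -> X0}) (B : R -> X0 -> X0) (b : R -> R),
    0 < T ->
    (* A(t) in L(X1,X0), strongly measurable in the strong operator topology *)
    (forall t, 0 <= t <= T -> exists c : R, forall x, `|A t x| <= c * `|x|) ->
    (forall x, strongly_meas `[0, T]%classic (fun t => A t x)) ->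
    (* ||A v||_{L^p} <= C_A ||v||_{MR^p} *)
    (exists CA : R, forall v : R -> X1, MR J p kappa 0 T v ->
        wLp p kappa 0 T (fun t => A t (v t)) /\
        forall g c, is_deriv p kappa 0 T (J \o v) g c ->
          wLp_norm p kappa 0 T (fun t => A t (v t)) <= CA * MR_norm J p kappa 0 T v g) ->
    max_reg J p kappa (fun t => A t) 0 T ->
    MR_const J p kappa (fun t => A t) 0 T = M ->
    (* B(t) in L(X_{1-1/q,1}, X0), strongly measurable in the SOT, ||B(t)|| <= b(t) *)
    (forall t, forall x y, in_interp J (1 - q^-1) x -> in_interp J (1 - q^-1) y ->
        B t (x + y) = B t x + B t y) ->
    (forall t c x, in_interp J (1 - q^-1) x -> B t (c *: x) = c *: B t x) ->
    (forall x, in_interp J (1 - q^-1) x -> strongly_meas `[0, T]%classic (fun t => B t x)) ->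
    (forall t, 0 <= t <= T -> forall x, in_interp J (1 - q^-1) x ->
        `|B t x| <= b t * interp_norm J (1 - q^-1) x) ->
    measurable_fun `]0, T[%classic b ->
    Lq_fin q 0 T b ->
    Lq_norm q 0 T b = N ->
    max_reg J p kappa (fun t x => A t x + B t (J x)) 0 T /\
    MR_const J p kappa (fun t x => A t x + B t (J x)) 0 T <= C.
Proof.
have p0 : 0 < p by exact: lt_trans hp.
have q1 : 1 < q by exact: lt_trans hq.
pose K := Num.max (M + 1) 1.
have K0 : 0 < K by rewrite lt_max ltr01 orbT.
have [delta [lam [delta0 lam0 rate_le]]] :=
  exists_perturb_rate_le kappa p0 (lt_trans ltr01 q1) (powR_gt0 p K0) (contraction_ratio_gt0 p).
exists (K * (2 * 2 `^ p * expR (lam * N `^ q)) `^ p^-1).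
move=> T A B b T0 _ _ _ [solA [K' estK']] MA B_add B_scale B_meas B_norm b_meas b_fin bN.
have theta : 0 < 1 - q^-1 < 1.
  by rewrite subr_gt0 invf_lt1 ?(lt_trans ltr01 q1)// q1 gtrBl invr_gt0 (lt_trans ltr01).
have [c _ J_interp_le] := interp_embedding J_cont theta.
have J_interp x : in_interp J (1 - q^-1) (J x) by exact: (J_interp_le x).1.
have EP : interp_perturbation J q T (fun t x => B t (J x)) b.
  split=> // [t k x y|x|t tT x]; [|exact: B_meas|exact: B_norm].
  by rewrite linearD B_add ?linearZ ?B_scale// -linearZ.
have estK : MR_est J p kappa (fun t => A t) 0 T K.
  by apply: MR_est_gt_const; [exists K'|rewrite MA lt_max ltrDl ltr01].
have estC := perturbed_MR_est J_cont hp hq hkappa EP K0 delta0 lam0 rate_le estK.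
rewrite bN in estC; split; last by apply: MR_const_le estC; rewrite mulr_ge0 ?powR_ge0 ?(ltW K0).
apply: (max_reg_of_est p0 T0 _ estC) => [t x y|].
  by rewrite linearB (perturb_sub EP) opprD addrACA.
apply: (perturbed_solution J_cont hp hq hkappa T0 EP _ K0 delta0 lam0 rate_le estK) => [t x y|f wf].
  exact: linearB.
by have [u [Mu [Su _]]] := solA f wf; exists u.
Qed.
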